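(* Let $\alpha>0$ and let $$H_\alpha(z):=\sum_{k=0}^\infty \frac{(-z)^k}{k!\prod_{j=1}^k\big(j-\frac{1}{1+\alpha}\big)},\qquad z\in\mathbb{C}.$$ All zeros of $H_\alpha$ in $\mathbb{C}$ are real and positive. Let $\{h_n(\alpha)\}_{n\in\mathbb{N}}$ be the sequence of these zeros, ordered by their size. The point spectrum (set of eigenvalues) of $T_\alpha^*T_\alpha$ on $L^2[0,1]$ is $$\sigma_0(T_\alpha^*T_\alpha)=\Big\{\frac{\alpha}{(1+\alpha)^2}\,\frac{1}{h_n(\alpha)}\colon n\in\mathbb{N}\Big\},$$ each eigenspace is one-dimensional, and the $n$-th eigenspace (the one for the eigenvalue $\frac{\alpha}{(1+\alpha)^2 h_n(\alpha)}$) is generated by the function $$x\mapsto \sum_{k=0}^\infty \frac{(-h_n(\alpha))^k}{k!\prod_{j=1}^k\big(j-\frac{1}{1+\alpha}\big)}\,x^{\frac{(1+\alpha)k}{\alpha}}.$$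
   Context: For real $\alpha>0$, $T_\alpha\colon L^2[0,1]\to L^2[0,1]$ is the bounded linear operator $(T_\alpha f)(x):=\int_0^{x^\alpha} f(y)\,dy$, and $T_\alpha^*$ is its adjoint, $(T_\alpha^*f)(x)=\int_{x^{1/\alpha}}^1 f(u)\,du$. $\mathbb{N}=\{0,1,2,\dots\}$; empty products equal $1$. *)

(* Defs.v *)
From HB Require Import structures.
From mathcomp Require Import all_boot all_order all_algebra.
From mathcomp Require Import all_classical all_reals all_analysis.
From mathcomp Require Import measurable_realfun complex.

Set Implicit Arguments.
Unset Strict Implicit.
Unset Printing Implicit Defensive.

Import Order.TTheory GRing.Theory Num.Theory.
Import numFieldNormedType.Exports.

Local Open Scope classical_set_scope.
Local Open Scope complex_scope.
Local Open Scope ring_scope.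

Section L2_unit_interval.
Context {R : realType}.

Definition unit_itv : set R := `[0, 1].

(** The integral of a complex-valued function, taken componentwise. *)
Definition cintegral (D : set R) (f : R -> R[i]) : R[i] :=
  (\int[lebesgue_measure]_(x in D) complex.Re (f x)) +i*
  (\int[lebesgue_measure]_(x in D) complex.Im (f x)).

(** The elements of the complex Hilbert space L^2[0,1] are represented by
    functions on R whose values outside [0,1] are irrelevant; equality in
    L^2[0,1] is [L2eq]. *)
Definition L2 : set (R -> R[i]) := [set f : R -> R[i] |
  [/\ measurable_fun unit_itv (@complex.Re R \o f),
      measurable_fun unit_itv (@complex.Im R \o f) &
      (\int[lebesgue_measure]_(x in unit_itv)
         (Normc.normc (f x) ^+ 2)%:E < +oo)%E]].

Definition L2eq (f g : R -> R[i]) : Prop :=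
  ae_eq lebesgue_measure unit_itv f g.

Definition L2inner (f g : R -> R[i]) : R[i] :=
  cintegral unit_itv (fun x => f x * conjc (g x)).

(** [A] stands for a linear operator on L^2[0,1], given by its action on
    representatives. *)
Definition L2_eigenspace (A : (R -> R[i]) -> R -> R[i]) (l : R[i]) :
    set (R -> R[i]) :=
  [set f | L2 f /\ L2eq (A f) (fun x => l * f x)].

Definition L2_point_spectrum (A : (R -> R[i]) -> R -> R[i]) : set R[i] :=
  [set l | exists2 f, L2_eigenspace A l f & ~ L2eq f (fun=> 0)].

(** The line generated by the class of [phi], as a set of representatives. *)
Definition L2span (phi : R -> R[i]) : set (R -> R[i]) :=
  [set f | L2 f /\ exists c : R[i], L2eq f (fun x => c * phi x)].

Definition one_dimensional (E : set (R -> R[i])) : Prop :=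
  exists phi, [/\ L2 phi, ~ L2eq phi (fun=> 0) & E = L2span phi].

Definition generated_by (E : set (R -> R[i])) (phi : R -> R[i]) : Prop :=
  L2 phi /\ E = L2span phi.

End L2_unit_interval.

Section operators.
Context {R : realType}.
Variable a : R.

Definition Talpha (f : R -> R[i]) : R -> R[i] :=
  fun x => cintegral `[0, x `^ a] f.

Definition Talpha_adj (f : R -> R[i]) : R -> R[i] :=
  fun x => cintegral `[x `^ a^-1, 1] f.

Definition Hdenom (k : nat) : R :=
  k`!%:R * \prod_(1 <= j < k.+1) (j%:R - (1 + a)^-1).

(** [R[i]^o] is [R[i]] with the topology of its modulus. *)
Definition Halpha (z : R[i]) : R[i] :=
  limn (series (fun k => (- z) ^+ k / (Hdenom k)%:C : R[i]^o)).

Definition eigenfun (h : R) : R -> R[i] := fun x =>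
  (limn (series (fun k =>
     (- h) ^+ k / Hdenom k * x `^ ((1 + a) * k%:R / a))))%:C.

End operators.

(** [Talpha_adj] is the Hilbert space adjoint of [Talpha] (lemma
    [Talpha_adjP] below). *)
Section adjoint.
Context {R : realType}.
Variable a : R.
Hypothesis a_gt0 : 0 < a.
Local Notation mu := (@lebesgue_measure R).
Local Notation I := (@unit_itv R).

Lemma unit_itvE (x : R) : I x = (0 <= x <= 1) :> Prop.
Proof. by rewrite /unit_itv/= in_itv. Qed.

Lemma measurable_unit_itv : measurable (I : set R). Proof. exact: measurable_itv. Qed.
#[local] Hint Resolve measurable_unit_itv : core.

Lemma powR01 (x b : R) : 0 < b -> 0 <= x <= 1 -> 0 <= x `^ b <= 1.
Proof.
move=> b0 /andP[x0 x1]; rewrite powR_ge0/=.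
have <- : 1 `^ b = 1 :> R by rewrite powR1.
by apply: ge0_ler_powR => //; rewrite ?nnegrE// ltW.
Qed.

Lemma powR_galois (x y : R) : 0 <= x -> 0 <= y -> (y <= x `^ a) = (y `^ a^-1 <= x).
Proof.
move=> x0 y0; have an0 : a != 0 by rewrite gt_eqF.
apply/idP/idP => [yx|yx].
- rewrite -[leRHS](@powRr1 _ x)// -(mulfV an0) powRrM.
  by apply: ge0_ler_powR => //; rewrite ?nnegrE ?powR_ge0// invr_ge0 ltW.
- rewrite -[leLHS](@powRr1 _ y)// -(mulVf an0) powRrM.
  by apply: ge0_ler_powR => //; rewrite ?nnegrE ?powR_ge0// ltW.
Qed.

Section real.
Variables f g : R -> R.
Hypothesis fi : mu.-integrable I (EFin \o f).
Hypothesis gi : mu.-integrable I (EFin \o g).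

Let E : set (R * R) := [set z | z.2 <= z.1 `^ a].
Let K (z : R * R) : R := (f \_ I) z.2 * (g \_ I) z.1 * \1_E z.

Let mE : measurable E.
Proof.
rewrite /E -[X in measurable X]setTI.
have -> : [set z : R * R | z.2 <= z.1 `^ a] =
   (fun z : R * R => z.1 `^ a - z.2) @^-1` `[0, +oo[.
  by apply/seteqP; split => z /=; rewrite in_itv/= andbT subr_ge0.
apply: (_ : measurable_fun setT _) => //.
apply: measurable_realfun.measurable_funB => //.
by apply: (measurableT_comp (measurable_powR _)).
Qed.

Let mfI : measurable_fun setT (f \_ I).
Proof.
by apply/(measurable_restrictT _ measurable_unit_itv)/measurable_EFinP; exact: measurable_int fi.
Qed.

Let mgI : measurable_fun setT (g \_ I).
Proof.
by apply/(measurable_restrictT _ measurable_unit_itv)/measurable_EFinP; exact: measurable_int gi.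
Qed.

Let mK : measurable_fun setT K.
Proof.
apply: measurable_funM; last exact: measurable_indic.
by apply: measurable_funM; [apply: (measurableT_comp mfI)|apply: (measurableT_comp mgI)].
Qed.

Let fiT : mu.-integrable setT (EFin \o (f \_ I)).
Proof. by rewrite -restrict_EFin; apply/integrable_restrict => //; rewrite setTI. Qed.

Let giT : mu.-integrable setT (EFin \o (g \_ I)).
Proof. by rewrite -restrict_EFin; apply/integrable_restrict => //; rewrite setTI. Qed.

Let iK : (mu \x mu)%E.-integrable setT (EFin \o K).
Proof.
apply/integrable12ltyP; first exact/measurable_EFinP.
have /integrableP[_ fi'] := fiT; have /integrableP[_ gi'] := giT.
apply: (@le_lt_trans _ _
  (\int[mu]_x (`|(g \_ I) x|%:E * \int[mu]_y `|(f \_ I) y|%:E))%E); last first.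
  rewrite ge0_integralZr//; last 2 first.
  - by apply/measurable_EFinP; apply: measurableT_comp.
  - by apply: integral_ge0.
  by rewrite lte_mul_pinfty//; [exact: integral_ge0|rewrite ge0_fin_numE//; exact: integral_ge0].
apply: ge0_le_integral => //.
- by move=> x _; exact: integral_ge0.
- apply: (@measurable_fun_fubini_tonelli_F _ _ _ _ _ mu (fun z => `|(K z)%:E|%E)) => //=.
  by apply/measurable_EFinP; apply: measurableT_comp.
- apply: emeasurable_funM => //; by apply/measurable_EFinP; apply: measurableT_comp.
- move=> x _; rewrite -ge0_integralZl//; last by apply/measurable_EFinP; apply: measurableT_comp.
  apply: ge0_le_integral => //.
  + apply/measurable_EFinP/measurableT_comp => //.
    exact: (measurableT_comp mK (measurable_pair1 _)).
  + apply/measurable_EFinP/measurable_funM => //; exact/measurableT_comp.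
  + move=> y _; rewrite lee_fin /K !normrM [leRHS]mulrC ler_piMr// ?mulr_ge0//.
    by rewrite indicE; case: (_ \in _); rewrite ?normr1 ?normr0.
Qed.

Lemma integrable_sub (A : set R) (h : R -> R) : measurable A -> A `<=` I ->
  mu.-integrable I (EFin \o h) -> mu.-integrable A (EFin \o h).
Proof. by move=> mA AI; apply: integrableS. Qed.

Let FE x : (\int[mu]_y (K (x, y))%:E =
   (((fun x => (\int[mu]_(y in `[0%R, x `^ a]) f y) * g x) \_ I) x)%:E)%E.
Proof.
rewrite /K /= [in RHS]patchE; case: ifPn => [xI|xI]; last first.
  by under eq_integral do rewrite [X in _ * X * _]patchE (negbTE xI) mulr0 mul0r; rewrite integral0.
have x01 : 0 <= x <= 1 by move: xI; rewrite inE unit_itvE.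
have /andP[xa0 xa1] := powR01 a_gt0 x01.
have sub : `[0, x `^ a] `<=` I.
  move=> y /=; rewrite in_itv/= unit_itvE => /andP[-> /le_trans]; exact.
rewrite EFinM /Rintegral fineK; last first.
  apply: integrable_fin_num => //; exact: (integrable_sub _ sub).
rewrite muleC -integralZl//; last exact: (integrable_sub _ sub).
rewrite [RHS]integral_mkcond; apply: eq_integral => y _.
rewrite ![in RHS]patchE ![in LHS]patchE xI indicE.
have [yA|yA] := boolP (y \in `[0, x `^ a]%classic).
  have yI : y \in I by rewrite inE; apply: sub; rewrite -inE.
  rewrite yI (_ : _ \in E) ?mulr1 ?EFinM 1?muleC//.
  by move: yA; rewrite !inE/= in_itv/= => /andP[].
case: ifPn => yI; last by rewrite !mul0r.
rewrite (_ : _ \in E = false) ?mulr0//; apply/negbTE; apply: contra yA.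
rewrite !inE/= in_itv/= => ->; rewrite andbT.
by move: yI; rewrite inE unit_itvE => /andP[].
Qed.

Let GE y : (\int[mu]_x (K (x, y))%:E =
   (((fun y => f y * \int[mu]_(x in `[y `^ a^-1, 1%R]) g x) \_ I) y)%:E)%E.
Proof.
rewrite /K /= [in RHS]patchE; case: ifPn => [yI|yI]; last first.
  by under eq_integral do rewrite [X in X * _ * _]patchE (negbTE yI) !mul0r; rewrite integral0.
have y01 : 0 <= y <= 1 by move: yI; rewrite inE unit_itvE.
have sub : `[y `^ a^-1, 1] `<=` I.
  move=> x /=; rewrite in_itv/= unit_itvE => /andP[+ ->]; rewrite andbT.
  by apply: le_trans; exact: powR_ge0.
rewrite EFinM /Rintegral fineK; last first.
  apply: integrable_fin_num => //; exact: (integrable_sub _ sub).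
rewrite -integralZl//; last exact: (integrable_sub _ sub).
rewrite [RHS]integral_mkcond; apply: eq_integral => x _.
rewrite ![in RHS]patchE ![in LHS]patchE yI indicE.
have [xA|xA] := boolP (x \in `[y `^ a^-1, 1]%classic).
  have xI : x \in I by rewrite inE; apply: sub; rewrite -inE.
  rewrite xI (_ : _ \in E) ?mulr1//.
  move: xA xI; rewrite !inE/= in_itv/= unit_itvE => /andP[yx _] /andP[x0 _].
  by rewrite /E/= powR_galois//; case/andP: y01.
case: ifPn => xI; last by rewrite mulr0 mul0r.
rewrite (_ : _ \in E = false) ?mulr0//; apply/negbTE; apply: contra xA.
move: xI; rewrite !inE/= in_itv/= unit_itvE => /andP[x0 ->]; rewrite andbT.
by rewrite /E/= powR_galois//; case/andP: y01.
Qed.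

Lemma real_integrableF :
  mu.-integrable I (EFin \o (fun x => (\int[mu]_(y in `[0, x `^ a]) f y) * g x)).
Proof.
apply/integrable_mkcond => //; rewrite restrict_EFin.
have := integrable_fubini_F iK; apply: eq_integrable => // x _.
exact: FE.
Qed.

Lemma real_adj :
  \int[mu]_(x in I) ((\int[mu]_(y in `[0, x `^ a]) f y) * g x) =
  \int[mu]_(y in I) (f y * \int[mu]_(x in `[y `^ a^-1, 1]) g x).
Proof.
rewrite [LHS]Rintegral_mkcond [RHS]Rintegral_mkcond /Rintegral; congr fine.
transitivity (\int[mu]_x \int[mu]_y (K (x, y))%:E)%E.
  by apply: eq_integral => x _; rewrite FE.
transitivity (\int[mu]_y \int[mu]_x (K (x, y))%:E)%E.
  exact: (@Fubini _ _ _ _ _ mu mu _ iK).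
by apply: eq_integral => y _; rewrite GE.
Qed.

Lemma real_integrableG :
  mu.-integrable I (EFin \o (fun y => f y * \int[mu]_(x in `[y `^ a^-1, 1]) g x)).
Proof.
apply/integrable_mkcond => //; rewrite restrict_EFin.
have mG := measurable_fubini_G iK.
have iG : mu.-integrable setT (fubini_G mu (EFin \o K)).
  apply/integrableP; split => //.
  have mEK : measurable_fun setT (EFin \o K) by exact/measurable_EFinP.
  apply: le_lt_trans ((integrable21ltyP mu mu mEK).1 iK).
  apply: ge0_le_integral => //.
  - exact: measurableT_comp.
  - apply: (@measurable_fun_fubini_tonelli_G _ _ _ _ _ mu (fun z => `|(K z)%:E|%E)) => //=.
    by apply/measurable_EFinP; apply: measurableT_comp.
  - move=> y _; apply: le_abse_integral => //.
    apply/measurable_EFinP; exact: (measurableT_comp mK (measurable_pair2 _)).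
apply: eq_integrable iG => // x _.
exact: GE.
Qed.

End real.

Lemma L2_integrable (f : R -> R[i]) : L2 f ->
  mu.-integrable I (EFin \o (@complex.Re R \o f)) /\
  mu.-integrable I (EFin \o (@complex.Im R \o f)).
Proof.
move=> [mRe mIm fi].
have mN : measurable_fun I (fun x => (Normc.normc (f x) ^+ 2)%:E).
  rewrite (_ : (fun x => _) = EFin \o (fun x => complex.Re (f x) ^+ 2 + complex.Im (f x) ^+ 2)).
    by apply/measurable_EFinP; apply: measurable_funD; apply: measurable_funX.
  apply/funext => x; congr EFin; case: (f x) => u v /=.
  by rewrite sqr_sqrtr// addr_ge0// sqr_ge0.
have iN : mu.-integrable I (fun x => 1 + (Normc.normc (f x) ^+ 2)%:E)%E.
  apply: integrableD => //.
  - apply/integrableP; split=> //; rewrite integral_cst//= lebesgue_measure_itv/= lte_fin ltr01.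
    by rewrite oppr0 adde0 mule1 ltry.
  - apply/integrableP; split=> //.
    by under eq_integral do rewrite gee0_abs ?lee_fin ?sqr_ge0//.
have bnd (u n : R) : u ^+ 2 <= n ^+ 2 -> `|u| <= 1 + n ^+ 2.
  rewrite -(real_normK (num_real u)) => un.
  have [u1|/ltW u1] := leP `|u| 1; first by rewrite (le_trans u1)// lerDl sqr_ge0.
  apply: (@le_trans _ _ (n ^+ 2)); last by rewrite lerDr ler01.
  by apply: le_trans un; rewrite expr2 ler_peMl.
split; apply: (le_integrable _ _ _ iN) => //.
- exact/measurable_EFinP.
- move=> x _ /=; rewrite lee_fin [leRHS]ger0_norm ?addr_ge0 ?sqr_ge0//.
  rewrite bnd//; case: (f x) => u v /=.
  by rewrite sqr_sqrtr ?addr_ge0 ?sqr_ge0// lerDl sqr_ge0.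
- exact/measurable_EFinP.
- move=> x _ /=; rewrite lee_fin [leRHS]ger0_norm ?addr_ge0 ?sqr_ge0//.
  rewrite bnd//; case: (f x) => u v /=.
  by rewrite sqr_sqrtr ?addr_ge0 ?sqr_ge0// lerDr sqr_ge0.
Qed.

Lemma Talpha_adjP (f g : R -> R[i]) : L2 f -> L2 g ->
  L2inner (Talpha a f) g = L2inner f (Talpha_adj a g).
Proof.
move=> /L2_integrable[f1 f2] /L2_integrable[g1 g2].
set p1 := _ \o f in f1; set p2 := _ \o f in f2.
set q1 := _ \o g in g1; set q2 := _ \o g in g2.
have L x : Talpha a f x * conjc (g x) =
   ((\int[mu]_(y in `[0%R, x `^ a]) p1 y) * q1 x + (\int[mu]_(y in `[0%R, x `^ a]) p2 y) * q2 x) +i*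
   ((\int[mu]_(y in `[0%R, x `^ a]) p2 y) * q1 x - (\int[mu]_(y in `[0%R, x `^ a]) p1 y) * q2 x).
  rewrite /Talpha /cintegral /q1 /q2 /=; case: (g x) => u v.
  by apply/eqP; rewrite eq_complex /= !mulrN ?opprK eqxx addrC eqxx.
have M y : f y * conjc (Talpha_adj a g y) =
   (p1 y * (\int[mu]_(x in `[y `^ a^-1, 1%R]) q1 x) +
    p2 y * (\int[mu]_(x in `[y `^ a^-1, 1%R]) q2 x)) +i*
   (p2 y * (\int[mu]_(x in `[y `^ a^-1, 1%R]) q1 x) -
    p1 y * (\int[mu]_(x in `[y `^ a^-1, 1%R]) q2 x)).
  rewrite /Talpha_adj /cintegral /p1 /p2 /=; case: (f y) => u v.
  by apply/eqP; rewrite eq_complex /= !mulrN ?opprK eqxx addrC eqxx.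
rewrite /L2inner; under eq_fun do rewrite L; under [in RHS]eq_fun do rewrite M.
rewrite /cintegral; congr (_ +i* _).
- rewrite !RintegralD//; do ?[exact: real_integrableF|exact: real_integrableG].
  by rewrite !real_adj.
- rewrite !RintegralB//; do ?[exact: real_integrableF|exact: real_integrableG].
  by rewrite !real_adj.
Qed.
End adjoint.

(* Main.v *)
Require Import Defs.
From HB Require Import structures.
From mathcomp Require Import all_boot all_order all_algebra.
From mathcomp Require Import all_classical all_reals all_analysis.
From mathcomp Require Import measurable_realfun complex ring lra.

Import Order.TTheory GRing.Theory Num.Theory.
Import numFieldNormedType.Exports.

Local Open Scope classical_set_scope.
Local Open Scope complex_scope.
Local Open Scope ring_scope.

(** Write T for the operator T_a, H for the entire series of the statement,
    theta = 1 / (1 + a), beta = (1 + a) / a and K = a / (1 + a)^2.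

    The operator S = T_(1/a) T_a is an iterated primitive and
    T* T f = S f(1) - S f on [0,1].  The coefficients of H are chosen so that
    phi_h(x) = H(h x^beta) satisfies S phi_h = l - l phi_h with l = K / h
    ([volterra2_psum], which integrates power series term by term).  So if
    H(h) = phi_h(1) = 0, then T* T phi_h = l phi_h.

    Conversely, let T* T f = l f with f nonzero in L^2.  Since T* T is
    positive, l >= 0 ([eigenvalue_ge0]); since S f is constant only for f = 0,
    l <> 0 ([volterra2_inj]).  After changing f on a null set,
    f = (S f(1) - S f) / l holds everywhere; subtracting the multiple of phi_h
    (h = K / l) with the value S f(1) / l at 0 leaves a bounded w with
    l w = - S w.  Such a w vanishes ([volterra2_unique]): the positive function
    E(x) = H(- h x^beta) satisfies S E = l E - l, so the best constant m with
    |w| <= m E also satisfies |w| <= m (E - 1), which is better unless m = 0.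
    Hence f = C phi_h, and evaluating at 1 gives H(h) = 0.

    A complex zero z of H gives in the same way an eigenfunction for the
    eigenvalue K / z, and positivity of T* T forces z to be real and positive
    ([Halpha_zero_real]).

    It remains to count the zeros on the positive half-line, where
    x H'' + nu H' + H = 0 with nu = 1 - theta in ]0,1[.  They are unbounded
    because (x^nu H')' = - x^(nu - 1) H and neither x^(- nu) nor x^(nu - 1) is
    integrable at infinity, so that no solution keeps a constant sign
    ([no_eventually_positive_solution]).  They are isolated because the energy
    x^2 H'^2 + x H^2 increases from 0 and is therefore positive for x > 0, so
    that H' does not vanish at a zero ([nonzero_slope]).  An unbounded, locally
    finite set of positive numbers is the range of an increasing sequence
    ([increasing_enumeration]). *)

Set Implicit Arguments.
Unset Strict Implicit.
Unset Printing Implicit Defensive.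

(** * Power series with factorially small coefficients *)
Section entire_series.
Context {R : realType}.
Implicit Types (c d : nat -> R) (x y : R).

(** A bound that makes the series converge everywhere and that is stable under
    formal differentiation; both are needed to differentiate twice. *)
Definition exp_dominated c :=
  exists A r : R, [/\ 0 <= A, 0 <= r & forall k, `|c k| <= A * (r ^+ k / k`!%:R)].

Definition psum c x : R := limn (pseries c x).

Lemma exp_dominatedM c d (B : R) : (forall k, `|d k| <= B) ->
  exp_dominated c -> exp_dominated (fun k => c k * d k).
Proof.
move=> dB [A [r [A0 r0 H]]]; have B0 : 0 <= B by exact: le_trans (dB 0).
exists (A * B), r; split=> // [|k]; first exact: mulr_ge0.
by rewrite normrM mulrAC ler_pM.
Qed.

Lemma exp_dominatedZ (l : R) c : exp_dominated c -> exp_dominated (fun k => l * c k).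
Proof.
move=> cd; have := @exp_dominatedM c (fun=> l) `|l| (fun=> lexx _) cd.
by under eq_fun do rewrite mulrC.
Qed.

Lemma exp_dominatedD c d : exp_dominated c -> exp_dominated d ->
  exp_dominated (fun k => c k + d k).
Proof.
move=> [A [r [A0 r0 H]]] [B [s [B0 s0 K]]].
exists (A + B), (r + s); split; rewrite ?addr_ge0// => k.
rewrite (le_trans (ler_normD _ _))// mulrDl lerD//.
  rewrite (le_trans (H k))// ler_wpM2l// ler_wpM2r// ?invr_ge0//.
  by rewrite lerXn2r// ?nnegrE ?addr_ge0// lerDl.
rewrite (le_trans (K k))// ler_wpM2l// ler_wpM2r// ?invr_ge0//.
by rewrite lerXn2r// ?nnegrE ?addr_ge0// lerDr.
Qed.

(** The factor k + 1 created by the derivative is absorbed by (k + 1)!. *)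
Lemma exp_dominated_diffs c : exp_dominated c -> exp_dominated (pseries_diffs c).
Proof.
move=> [A [r [A0 r0 H]]]; exists (A * r), r; split=> [||k]//; first exact: mulr_ge0.
rewrite /pseries_diffs normrM ger0_norm//.
apply: (le_trans (ler_wpM2l _ (H k.+1))) => //.
rewrite factS natrM exprS invfM mulrCA -!mulrA ler_wpM2l//.
rewrite [leLHS]mulrCA ler_wpM2l// [leLHS]mulrCA ler_wpM2l ?exprn_ge0//.
by rewrite mulrA divff ?mul1r// pnatr_eq0.
Qed.

Lemma exp_dominated_shift c : exp_dominated c -> exp_dominated (fun k => c k.+1).
Proof.
move=> /exp_dominated_diffs H.
rewrite (_ : (fun k => _) = (fun k => pseries_diffs c k * k.+1%:R^-1)).
  apply: (@exp_dominatedM _ _ 1) H => k; rewrite ger0_norm ?invr_ge0// invf_le1// ?ler1n//.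
by apply/funext => k; rewrite /pseries_diffs mulrAC divff ?mul1r// pnatr_eq0.
Qed.

(** The factor k is absorbed by doubling the ratio, as k <= 2^k. *)
Lemma exp_dominated_degree c : exp_dominated c -> exp_dominated (fun k => k%:R * c k).
Proof.
move=> [A [r [A0 r0 H]]]; exists A, (2 * r); split=> [//||k]; first exact: mulr_ge0.
rewrite normrM ger0_norm// exprMn -!mulrA [leRHS]mulrCA ler_pM//.
by rewrite -natrX ler_nat ltnW// ltn_expl.
Qed.

Lemma psum_normed_cvg c x : exp_dominated c -> cvgn [normed pseries c x].
Proof.
move=> [A [r [A0 r0 H]]].
apply: (@series_le_cvg _ _ (fun k => A * exp_coeff (r * `|x|) k)).
- by move=> n /=; exact: normr_ge0.
- by move=> n; rewrite mulr_ge0// exp_coeff_ge0// mulr_ge0.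
- move=> n /=; rewrite normrM normrX /exp_coeff/= exprMn.
  by rewrite [_ * _ / _]mulrAC mulrA ler_wpM2r// exprn_ge0.
- exact/is_cvg_seriesZ/is_cvg_series_exp_coeff.
Qed.

Lemma psum_cvg c x : exp_dominated c -> pseries c x @ \oo --> psum c x.
Proof. by move=> cd; apply: normed_cvg; exact: psum_normed_cvg. Qed.

Lemma psum_uniq c x l : pseries c x @ \oo --> l -> psum c x = l.
Proof. exact: cvg_lim. Qed.

Lemma psum_derive c x : exp_dominated c ->
  is_derive x 1 (psum c) (psum (pseries_diffs c) x).
Proof.
move=> cd; apply: (@pseries_snd_diffs _ _ (`|x| + 1)).
- by apply/cvg_ex; eexists; exact: psum_cvg.
- by apply/cvg_ex; eexists; apply: psum_cvg; exact: exp_dominated_diffs.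
- by apply/cvg_ex; eexists; apply: psum_cvg; do 2 apply: exp_dominated_diffs.
- by rewrite [ltRHS]ger0_norm ?addr_ge0// ltrDl.
Qed.

Lemma psum_continuous c : exp_dominated c -> continuous (psum c).
Proof.
move=> cd x; apply: differentiable_continuous; apply/derivable1_diffP.
by have [] := psum_derive x cd.
Qed.

Lemma psumZ (l : R) c x : exp_dominated c ->
  psum (fun k => l * c k) x = l * psum c x.
Proof.
move=> cd; apply: psum_uniq.
rewrite (_ : pseries _ _ = (fun n => l * pseries c x n)).
  by apply: cvgMr; exact: psum_cvg.
apply/funext => n; rewrite /pseries/series/= big_distrr/=.
by apply: eq_bigr => i _; rewrite mulrA.
Qed.

Lemma psumD c d x : exp_dominated c -> exp_dominated d ->
  psum (fun k => c k + d k) x = psum c x + psum d x.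
Proof.
move=> cd dd; apply: psum_uniq.
rewrite (_ : pseries _ _ = (fun n => pseries c x n + pseries d x n)).
  by apply: cvgD; exact: psum_cvg.
apply/funext => n; rewrite /pseries/series/= -big_split/=.
by apply: eq_bigr => i _; rewrite mulrDl.
Qed.

Lemma psum_shift c x : exp_dominated c ->
  psum c x = c 0%N + x * psum (fun k => c k.+1) x.
Proof.
move=> cd; apply: psum_uniq; rewrite -cvg_shiftS.
rewrite (_ : (fun n => _) = (fun n => c 0%N + x * pseries (fun k => c k.+1) x n)).
  apply: cvgD; first exact: cvg_cst.
  by apply: cvgMr; apply: psum_cvg; exact: exp_dominated_shift.
apply/funext => n; rewrite /pseries/series/= big_nat_recl// expr0 mulr1; congr +%R.
by rewrite big_distrr/=; apply: eq_bigr => i _; rewrite exprS mulrCA.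
Qed.

Lemma psum_at0 c : exp_dominated c -> psum c 0 = c 0%N.
Proof. by move=> /psum_shift ->; rewrite mul0r addr0. Qed.

(** The operator x d/dx is diagonal on powers of x.  This turns an Euler-type
    differential equation into a recurrence on coefficients. *)
Lemma psum_euler c x : exp_dominated c ->
  x * psum (pseries_diffs c) x = psum (fun k => k%:R * c k) x.
Proof.
by move=> /exp_dominated_degree/psum_shift ->; rewrite mul0r add0r.
Qed.

Lemma ler_psum c d x y : exp_dominated c -> exp_dominated d ->
  (forall k, c k * x ^+ k <= d k * y ^+ k) -> psum c x <= psum d y.
Proof.
move=> cc dd cdk; apply: ler_lim.
- by apply/cvg_ex; eexists; exact: psum_cvg.
- by apply/cvg_ex; eexists; exact: psum_cvg.
- by apply: nearW => n; apply: ler_sum => i _; exact: cdk.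
Qed.

End entire_series.

(** * Integrals of power series in a power of the variable *)
Section integrals.
Context {R : realType}.
Implicit Types (c d : nat -> R) (x y s b X : R).
Local Notation mu := (@lebesgue_measure R).

(** Continuity has to be relative to [0, X]: negative bases have power 1, so
    these functions jump at 0 unless s = 0. *)
Lemma powR_within_continuous s X : 0 <= s -> 0 < X ->
  {within `[0, X], continuous (fun x => x `^ s)}.
Proof.
rewrite le_eqVlt => /predU1P[<- _|s0 X0].
  by apply: continuous_subspaceT => x; under eq_fun do rewrite powRr0; exact: cvg_cst.
have cont x : 0 < x -> {for x, continuous (fun x => x `^ s)}.
  move=> x0; apply: differentiable_continuous; apply/derivable1_diffP.
  by have [] := is_derive1_powR s x0.
apply/(continuous_within_itvP _ X0); split => [x||].
- by rewrite in_itv/= => /andP[x0 _]; exact: cont.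
- by rewrite powR0 ?gt_eqF//; exact: powR_cvg0.
- by apply: cvg_at_left_filter; exact: cont.
Qed.

Lemma psum_powR_within_continuous c s b X : exp_dominated c ->
  0 <= s -> 0 <= b -> 0 < X ->
  {within `[0, X], continuous (fun x => x `^ s * psum c (x `^ b))}.
Proof.
move=> cd s0 b0 X0 x; apply: (@continuousM R (subspace `[0, X]) (fun x => x `^ s)
  (fun x => psum c (x `^ b))); first exact: powR_within_continuous.
apply: continuous_comp; first exact: powR_within_continuous.
exact: psum_continuous.
Qed.

Lemma exp_dominated_primitive c s b : 0 <= s -> 0 < b -> exp_dominated c ->
  exp_dominated (fun k => c k / (s + 1 + b * k%:R)).
Proof.
move=> s0 b0; apply: (@exp_dominatedM _ _ _ 1) => k.
have H : 1 <= s + 1 + b * k%:R.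
  by rewrite -addrA addrCA lerDl addr_ge0// mulr_ge0// ltW.
by rewrite ger0_norm ?invr_ge0 ?(le_trans _ H)// invf_le1// (lt_le_trans _ H).
Qed.

(** The right-hand side is a primitive of the integrand: differentiating
    X^(s + 1) p(X^b) gives X^s ((s + 1) p + b X^b p'(X^b)), and t p'(t)
    multiplies the k-th coefficient of p by k, so altogether this coefficient
    is multiplied by s + 1 + b k. *)
Lemma Rintegral_powR_psum c s b X : exp_dominated c -> 0 <= s -> 0 < b -> 0 <= X ->
  \int[mu]_(y in `[0, X]) (y `^ s * psum c (y `^ b)) =
  X `^ (s + 1) * psum (fun k => c k / (s + 1 + b * k%:R)) (X `^ b).
Proof.
move=> cd s0 b0.
have s10 : s + 1 != 0 by rewrite gt_eqF// ltr_wpDl.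
rewrite le_eqVlt => /predU1P[<-|X0].
  by rewrite set_itv1 Rintegral_set1 powR0// mul0r.
set k := fun k => c k / _.
have kd : exp_dominated k by exact: exp_dominated_primitive.
pose F x := x `^ (s + 1) * psum k (x `^ b).
have dF x : 0 < x -> is_derive x 1 F (x `^ s * psum c (x `^ b)).
  move=> x0.
  have d1 := is_derive1_powR (s + 1) x0.
  have d2 := is_derive1_powR b x0.
  have d3 : is_derive x 1 (psum k \o (fun x => x `^ b))
     (psum (pseries_diffs k) (x `^ b) * (b * x `^ (b - 1))).
    by apply: is_derive1_comp; exact: psum_derive.
  suff <- : x `^ (s + 1) *: (psum (pseries_diffs k) (x `^ b) * (b * x `^ (b - 1))) +
     psum k (x `^ b) *: ((s + 1) * x `^ (s + 1 - 1)) = x `^ s * psum c (x `^ b).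
    exact: is_deriveM.
  have xs : x `^ (s + 1) = x `^ s * x by rewrite powRD ?(gt_eqF x0) ?implybT// powRr1 ?ltW.
  have xb : x * x `^ (b - 1) = x `^ b by rewrite mulr_powRB1// ltW.
  rewrite addrK xs -![_ *: _]/(_ * _); set t := x `^ b in xb *.
  transitivity (x `^ s * ((s + 1) * psum k t + b * (t * psum (pseries_diffs k) t))).
    by rewrite -xb; ring.
  have ke := exp_dominated_degree kd.
  rewrite psum_euler// -(psumZ (s + 1) _ kd) -(psumZ b _ ke) -psumD; last 2 first.
  - exact: exp_dominatedZ.
  - exact: exp_dominatedZ.
  congr (_ * psum _ _); apply/funext => j; rewrite /k.
  have : s + 1 + b * j%:R != 0 by rewrite gt_eqF// ltr_pwDl ?ltr_wpDl// mulr_ge0// ltW.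
  by move=> h; field.
have cF : {within `[0, X], continuous F}.
  by apply: psum_powR_within_continuous => //; [exact: addr_ge0|exact: ltW].
have /(continuous_within_itvP _ X0)[_ cF0 cFX] := cF.
rewrite /Rintegral (@continuous_FTC2 _ _ F _ _ X0).
- by rewrite /= [in X in _ - X]/F powR0// mul0r subr0.
- by apply: psum_powR_within_continuous => //; exact: ltW.
- split; [|exact: cF0|exact: cFX].
  by move=> x; rewrite in_itv/= => /andP[x0 _]; have [] := dF _ x0.
- move=> x; rewrite in_itv/= => /andP[x0 _].
  by rewrite derive1E; have [] := dF _ x0.
Qed.
End integrals.

(** * Enumerating an unbounded, locally finite set *)
Section enumeration.
Context {R : realType}.

(** As no point is an accumulation point of Z, infima of subsets of Z are
    attained, so that each real number has a successor in Z.  Iterating the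
    successor from 0 reaches every element of Z: otherwise the sequence would
    be bounded and its supremum would be an accumulation point. *)
Lemma increasing_enumeration (Z : set R) :
  (forall z, Z z -> 0 < z) ->
  (forall x, exists2 z, Z z & x < z) ->
  (forall p, exists2 e, 0 < e & forall z, Z z -> `|z - p| < e -> z = p) ->
  exists h : nat -> R, (forall m n : nat, (m < n)%N -> h m < h n) /\ range h = Z.
Proof.
move=> Z0 Zoo Zdisc.
have next x : {m | [/\ Z m, x < m & forall z, Z z -> x < z -> m <= z]}.
  apply: cid; pose A := [set z | Z z /\ x < z].
  have A0 : A !=set0 by have [z Zz xz] := Zoo x; exists z.
  have lA : has_lbound A by exists x => z [_ /ltW].
  have [e e0 He] := Zdisc (inf A).
  have [z [Zz xz] ze] := inf_adherent e0 (conj A0 lA).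
  have iz : inf A <= z by apply: ge_inf.
  have zE : z = inf A.
    by apply: He => //; rewrite ger0_norm ?subr_ge0// ltrBlDl.
  by exists z; split=> // y Zy xy; rewrite zE; apply: ge_inf.
pose h := fix h n := if n is m.+1 then projT1 (next (h m)) else projT1 (next 0).
have hS n : h n < h n.+1 by rewrite /=; case: (next (h n)) => m [].
have hZ n : Z (h n) by case: n => [|n] /=; [case: (next 0)|case: (next (h n))] => m [].
have hinc : {homo h : m n / (m < n)%N >-> m < n} by by apply: homo_ltn => //; exact: lt_trans.
exists h; split => //.
apply/seteqP; split => [_ [n _ <-]//|z Zz].
have [n zn] : exists n, z <= h n.
  apply: contrapT => /forallNP Hz.
  have hz n : h n < z by rewrite ltNge; exact/negP.
  have A0 : range h !=set0 by exists (h 0%N), 0%N.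
  have uA : has_ubound (range h) by exists z => _ [n _ <-]; exact/ltW.
  have [e e0 He] := Zdisc (sup (range h)).
  have [_ [n _ <-] ne] := sup_adherent e0 (conj A0 uA).
  have us m : h m <= sup (range h) by apply: ub_le_sup => //; exists m.
  have hn : h n = sup (range h).
    by apply: He => //; rewrite distrC ger0_norm ?subr_ge0// ltrBlDl -ltrBlDr.
  by have := lt_le_trans (hS n) (us n.+1); rewrite hn ltxx.
case: (ex_minnP (ex_intro (fun n => z <= h n) n zn)) => -[|m] zm min_m.
- exists 0%N => //; apply/eqP; rewrite eq_le zm andbT /=.
  by case: (next 0) => m [_ _] /=; apply => //; exact: Z0.
- exists m.+1 => //; apply/eqP; rewrite eq_le zm andbT /=.
  have hm : h m < z by rewrite ltNge; apply/negP => /min_m; rewrite ltnn.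
  by case: (next (h m)) => y [_ _] /=; apply.
Qed.
End enumeration.

(** * Oscillation of the solutions of x f'' + nu f' + f = 0 *)
Section oscillation.
Context {R : realType}.
Implicit Types (f F dF : R -> R).

Lemma nonincreasing_of_derive F dF (x0 : R) :
  (forall x, x0 < x -> is_derive x 1 F (dF x)) -> (forall x, x0 < x -> dF x <= 0) ->
  forall x y, x0 < x -> x <= y -> F y <= F x.
Proof.
move=> D D0 x y x0x xy.
have xz z : z \in `[x, y] -> x0 < z.
  by rewrite in_itv/= => /andP[xz _]; exact: lt_le_trans xz.
have [| |c cxy] := @MVT_segment R F dF x y xy.
- by move=> z zxy; apply: D; apply: xz; exact: subset_itv_oo_cc zxy.
- apply: continuous_in_subspaceT => z; rewrite inE/= => /xz/D[+ _].
  by move=> /derivable1_diffP/differentiable_continuous.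
- move=> e; rewrite -subr_le0 e; apply: mulr_le0_ge0; last by rewrite subr_ge0.
  exact/D0/xz.
Qed.

Lemma powR_unbounded (s M x0 : R) : 0 < s -> exists2 t, x0 < t & M < t `^ s.
Proof.
move=> s0; pose t := Num.max x0 ((`|M| + 1) `^ s^-1) + 1.
have M1 : 0 <= `|M| + 1 by rewrite addr_ge0.
exists t; first by rewrite (@le_lt_trans _ _ (Num.max x0 ((`|M| + 1) `^ s^-1)))// ?ltrDl// le_max lexx.
apply: (@lt_le_trans _ _ (`|M| + 1)); first by rewrite (le_lt_trans (ler_norm _))// ltrDl.
have -> : `|M| + 1 = ((`|M| + 1) `^ s^-1) `^ s.
  by rewrite -powRrM mulVf ?gt_eqF// powRr1.
have ht : (`|M| + 1) `^ s^-1 <= t.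
  by rewrite (@le_trans _ _ (Num.max x0 ((`|M| + 1) `^ s^-1)))// ?lerDl// le_max lexx orbT.
apply: ge0_ler_powR => //; rewrite ?nnegrE ?powR_ge0//; first exact: ltW.
by rewrite (le_trans _ ht)// powR_ge0.
Qed.

(** Let P = x^nu f', so that P' = - x^(nu - 1) f < 0.  If P takes a negative
    value - c, then f' <= - c x^(- nu) from there on, whose integral diverges to
    minus infinity as nu < 1, against f > 0.  So P >= 0 and f is nondecreasing;
    then P' <= - m x^(nu - 1) for some m > 0, and as nu > 0 this makes P
    negative far away. *)
Lemma no_eventually_positive_solution (nu z0 : R) (f f1 f2 : R -> R) :
  0 < nu < 1 -> 0 < z0 ->
  (forall x : R, 0 < x -> is_derive x 1 f (f1 x)) ->
  (forall x : R, 0 < x -> is_derive x 1 f1 (f2 x)) ->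
  (forall x : R, 0 < x -> x * f2 x + nu * f1 x + f x = 0) ->
  ~ (forall x, z0 < x -> 0 < f x).
Proof.
move=> /andP[nu0 nu1] z00 Df Df1 ode fpos.
have pos (x : R) : z0 < x -> 0 < x by exact: lt_trans.
pose P x := x `^ nu * f1 x.
have DP (x : R) : 0 < x -> is_derive x 1 P (- (x `^ (nu - 1) * f x)).
  move=> x0; suff <- : x `^ nu *: f2 x + f1 x *: (nu * x `^ (nu - 1)) = - (x `^ (nu - 1) * f x).
    have := is_derive1_powR nu x0 => D; have D1 := Df1 _ x0; exact: is_deriveM.
  rewrite -![_ *: _]/(_ * _) -(mulr_powRB1 (ltW x0) nu0).
  have -> : f x = - (x * f2 x + nu * f1 x) by have := ode _ x0; lra.
  by ring.
have Pdec x y : z0 < x -> x <= y -> P y <= P x.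
  apply: nonincreasing_of_derive => {x y} x z0x; first by apply: DP; exact: pos.
  by rewrite oppr_le0 mulr_ge0 ?powR_ge0// ltW// fpos.
have Dpow (c s x : R) : s != 0 -> 0 < x -> is_derive x 1 (fun x => c / s * x `^ s) (c * x `^ (s - 1)).
  move=> s0 x0; suff <- : (c / s) *: (s * x `^ (s - 1)) = c * x `^ (s - 1).
    have := is_derive1_powR s x0 => D; exact: is_deriveZ.
  by rewrite -![_ *: _]/(_ * _); field.
have P0 x : z0 < x -> 0 <= P x.
  (* G is f minus the primitive of P x * t^(- nu). *)
  move=> z0x; rewrite leNgt; apply/negP => Px0.
  pose G t := f t + - P x / (1 - nu) * t `^ (1 - nu).
  have nu10 : 1 - nu != 0 by rewrite subr_eq0 gt_eqF.
  have Gdec t : x + 1 <= t -> G t <= G (x + 1).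
    move=> xt; apply: (@nonincreasing_of_derive G (fun t => f1 t + - P x * t `^ (1 - nu - 1)) x) => //.
    - move=> y xy; have y0 : 0 < y by apply: pos; exact: lt_trans xy.
      have := Dpow (- P x) _ _ nu10 y0 => D; have D1 := Df _ y0; exact: is_deriveD.
    - move=> y xy; have y0 : 0 < y by apply: pos; exact: lt_trans xy.
      have -> : 1 - nu - 1 = - nu by ring.
      have yn : 0 < y `^ nu by exact: powR_gt0.
      have := Pdec x y z0x (ltW xy); rewrite {1}/P powRN mulNr subr_le0.
      by rewrite ler_pdivlMr// mulrC.
    - by rewrite ltrDl.
  have cpos : 0 < - P x / (1 - nu) by rewrite divr_gt0 ?oppr_gt0// subr_gt0.
  have [|t xt] := @powR_unbounded (1 - nu) (G (x + 1) / (- P x / (1 - nu))) (x + 1) _.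
    by rewrite subr_gt0.
  rewrite ltr_pdivrMr// mulrC => Gt.
  have := Gdec t (ltW xt); rewrite {1}/G; have := fpos t.
  rewrite (lt_trans z0x)// ?(lt_trans _ xt)// ?ltrDl// => /(_ isT); lra.
pose z1 := z0 + 1.
have z01 : z0 < z1 by rewrite ltrDl.
have finc t : z1 <= t -> f z1 <= f t.
  move=> zt; rewrite -lerN2.
  apply: (@nonincreasing_of_derive (fun x => - f x) (fun x => - f1 x) z0) => // x z0x.
    have := Df x (pos _ z0x) => D; exact: is_deriveN.
  rewrite oppr_le0; have := P0 _ z0x; rewrite /P pmulr_rge0//.
  by rewrite powR_gt0// pos.
pose m := f z1.
have m0 : 0 < m by exact: fpos.
have nun0 : nu != 0 by rewrite gt_eqF.
pose Q t := P t + m / nu * t `^ nu.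
have Qdec t : z1 + 1 <= t -> Q t <= Q (z1 + 1).
  move=> zt; apply: (@nonincreasing_of_derive Q
    (fun t => - (t `^ (nu - 1) * f t) + m * t `^ (nu - 1)) z1) => //.
  - move=> y zy; have y0 : 0 < y by apply: pos; exact: lt_trans zy.
    have := Dpow m _ _ nun0 y0 => D; have D1 := DP _ y0; exact: is_deriveD.
  - move=> y zy; rewrite mulrC -mulNr -mulrDl mulr_le0_ge0 ?powR_ge0//.
    by rewrite addrC subr_le0; apply: finc; exact: ltW.
  - by rewrite ltrDl.
have cpos : 0 < m / nu by rewrite divr_gt0.
have [t zt] := @powR_unbounded nu (Q (z1 + 1) / (m / nu)) (z1 + 1) nu0.
rewrite ltr_pdivrMr// mulrC => Qt.
have := Qdec t (ltW zt); rewrite {1}/Q; have := P0 t.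
rewrite (lt_trans z01)// ?(lt_trans _ zt)// ?ltrDl// => /(_ isT); lra.
Qed.
End oscillation.

(** * Simplicity of the zeros *)
Section simple_zeros.
Context {R : realType}.

(** By the equation, the energy W = x^2 f'^2 + x f^2 has the derivative
    2 (1 - nu) x f'^2 + f^2 >= 0.  At a double zero p it vanishes, hence it
    vanishes on ]0, p] since it is nonnegative there; then f = 0 on ]0, p],
    against f 0 != 0. *)
Lemma nonzero_slope (nu p : R) (f f1 f2 : R -> R) :
  0 < nu < 1 -> 0 < p ->
  (forall x : R, is_derive x 1 f (f1 x)) ->
  (forall x : R, is_derive x 1 f1 (f2 x)) ->
  (forall x : R, x * f2 x + nu * f1 x + f x = 0) ->
  f 0 != 0 -> f p = 0 -> f1 p != 0.
Proof.
move=> /andP[nu0 nu1] p0 Df Df1 ode f0 fp; apply/eqP => f1p.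
pose W (x : R) := x ^+ 2 * f1 x ^+ 2 + x * f x ^+ 2.
pose W1 (x : R) := 2 * x * (1 - nu) * f1 x ^+ 2 + f x ^+ 2.
have DW (x : R) : is_derive x 1 W (W1 x).
  have D := Df x; have D1 := Df1 x.
  have -> : W = (id ^+ 2) * (f1 ^+ 2) + id * (f ^+ 2).
    by apply/funext => y; rewrite /W /= !fctE.
  have Did : is_derive x 1 (@id R) 1 by exact: is_derive_id.
  apply: (is_derive_eq (is_deriveD (is_deriveM (is_deriveX 2 Did) (is_deriveX 2 D1))
    (is_deriveM Did (is_deriveX 2 D)))).
  rewrite /W1 -![_ *: _]/(_ * _) /= !fctE.
  have e : x * f2 x = - (nu * f1 x + f x) by have := ode x; lra.
  transitivity (2 * x * f1 x * (x * f2 x) + 2 * x * f1 x ^+ 2 + 2 * x * f x * f1 x + f x ^+ 2).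
    by ring.
  by rewrite e; ring.
have Wle x : 0 < x -> x <= p -> W x <= W p.
  move=> x0 xp; rewrite -lerN2.
  apply: (@nonincreasing_of_derive R (fun x => - W x) (fun x => - W1 x) 0) => // y y0.
  rewrite oppr_le0; apply: addr_ge0; last exact: sqr_ge0.
  apply: mulr_ge0; last exact: sqr_ge0.
  by rewrite mulr_ge0 ?subr_ge0 ?mulr_ge0// ltW.
have fx0 x : 0 < x -> x <= p -> f x = 0.
  move=> x0 xp; have := Wle x x0 xp.
  rewrite [in W p]/W fp f1p expr0n/= !mulr0 addr0 => Wx.
  have a0 : 0 <= x ^+ 2 * f1 x ^+ 2 by rewrite mulr_ge0 ?sqr_ge0.
  have b0 : 0 <= x * f x ^+ 2 by rewrite mulr_ge0 ?sqr_ge0// ltW.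
  have /eqP : x * f x ^+ 2 = 0 by apply/eqP; rewrite eq_le b0 andbT; move: Wx a0; rewrite /W; lra.
  by rewrite mulf_eq0 gt_eqF//= sqrf_eq0 => /eqP.
have cf : {for 0, continuous f}.
  by apply: differentiable_continuous; apply/derivable1_diffP; have [] := Df 0.
have : f x @[x --> 0^'+] --> f 0 by apply: cvg_at_right_filter; exact: cf.
have : f x @[x --> 0^'+] --> 0.
  apply: cvg_near_cst; near=> x; apply: fx0; first by near: x; exact: nbhs_right_gt.
  by near: x; exact: nbhs_right_le.
move=> h1 h2; move: f0; rewrite (cvg_unique _ h2 h1) ?eqxx//.
Unshelve. all: by end_near. Qed.

Lemma isolated_zero (f : R -> R) (l p : R) : is_derive p 1 f l -> (f p = 0 -> l != 0) ->
  exists2 e : R, 0 < e & forall z, f z = 0 -> `|z - p| < e -> z = p.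
Proof.
move=> Df; have cf : {for p, continuous f}.
  by apply: differentiable_continuous; apply/derivable1_diffP; have [] := Df.
have [fp|fp] := eqVneq (f p) 0.
- move=> /(_ fp) l0; have [/cvg_ex[/= l' dl'] dl] := Df.
  have ll' : l' = l by rewrite -dl; apply/esym/cvg_lim.
  subst l'.
  have [e /= e0 He] := cvgr_neq0 _ dl' l0.
  exists e => // z fz ze; apply/eqP/negPn/negP => zp.
  have := He (z - p); rewrite /ball_/= sub0r normrN => /(_ ze).
  by rewrite subr_eq0 => /(_ zp); rewrite [_%:A]mulr1 subrK fz fp subrr scaler0 eqxx.
- move=> _; have [e /= e0 He] := cvgr_neq0 _ cf fp.
  exists e => // z fz ze; have := He z; rewrite /ball_/= distrC => /(_ ze).
  by rewrite fz eqxx.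
Qed.
End simple_zeros.

(** * The entire series H and its real zeros *)
Section Hseries.
Context {R : realType}.
Variable a : R.
Hypothesis a_gt0 : 0 < a.
Local Notation theta := ((1 + a)^-1).

Lemma theta01 : 0 < theta < 1.
Proof. by rewrite invr_gt0 invf_lt1 ?ltrDl ?a_gt0 ?addr_gt0. Qed.

Lemma Hdenom0 : Hdenom a 0 = 1.
Proof. by rewrite /Hdenom big_geq// mulr1 fact0. Qed.

Lemma HdenomS k : Hdenom a k.+1 = Hdenom a k * (k.+1%:R * (k.+1%:R - theta)).
Proof. by rewrite /Hdenom factS natrM big_nat_recr//=; ring. Qed.

Lemma Hfactor_gt0 k : 0 < k.+1%:R * (k.+1%:R - theta).
Proof.
have /andP[_ t1] := theta01.
by rewrite mulr_gt0// subr_gt0 (lt_le_trans t1)// ler1n.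
Qed.

Lemma Hdenom_gt0 k : 0 < Hdenom a k.
Proof.
elim: k => [|k IH]; first by rewrite Hdenom0.
by rewrite HdenomS mulr_gt0// Hfactor_gt0.
Qed.

(** Apart from the first one, the factors j - theta are at least 1. *)
Lemma Hdenom_ge k : (1 - theta) * k`!%:R <= Hdenom a k.
Proof.
have /andP[t0 t1] := theta01.
elim: k => [|[|k] IH]; first by rewrite Hdenom0 fact0 mulr1 gerBl ltW.
  by rewrite HdenomS Hdenom0 (_ : 1`! = 1)%N// !mul1r mulr1.
rewrite HdenomS factS natrM mulrCA [leRHS]mulrCA ler_wpM2l//.
rewrite (le_trans IH)// ler_peMr ?(ltW (Hdenom_gt0 _))// lerBrDr.
have k1 : 1 <= k.+1%:R :> R by rewrite ler1n.
by rewrite -[k.+2%:R]natr1; lra.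
Qed.

Lemma exp_dominated_Hdenom (c : nat -> R) (r : R) : 0 <= r ->
  (forall k, `|c k| <= r ^+ k / Hdenom a k) -> exp_dominated c.
Proof.
move=> r0 H; have /andP[t0 t1] := theta01.
have t1' : 0 < 1 - theta by rewrite subr_gt0.
exists (1 - theta)^-1, r; split=> // [|k]; first by rewrite invr_ge0 ltW.
apply: (le_trans (H k)); rewrite mulrCA ler_wpM2l ?exprn_ge0//.
by rewrite -invfM lef_pV2 ?posrE ?Hdenom_gt0 ?Hdenom_ge// mulr_gt0// ltr0n fact_gt0.
Qed.

(** The Taylor coefficients of x |-> H(h x); the series H itself is
    [psum (Hcoef 1)]. *)
Definition Hcoef (h : R) k : R := (- h) ^+ k / Hdenom a k.

Lemma exp_dominated_Hcoef h : exp_dominated (Hcoef h).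
Proof.
apply: (@exp_dominated_Hdenom _ `|h|) => // k.
by rewrite normrM normrX normrN normfV (ger0_norm (ltW (Hdenom_gt0 k))).
Qed.
#[local] Hint Resolve exp_dominated_Hcoef : core.

Lemma psum_Hcoef h x : psum (Hcoef h) x = psum (Hcoef 1) (h * x).
Proof.
rewrite /psum; suff -> : pseries (Hcoef h) x = pseries (Hcoef 1) (h * x) by [].
apply/funext => n; apply: eq_bigr => k _.
by rewrite /= /Hcoef -[- h]mulN1r !exprMn; ring.
Qed.

Lemma HcoefS h k : Hcoef h k.+1 * (k.+1%:R * (k.+1%:R - theta)) = - h * Hcoef h k.
Proof.
have f0 := lt0r_neq0 (Hfactor_gt0 k); have d0 := lt0r_neq0 (Hdenom_gt0 k).
rewrite /Hcoef HdenomS; set p := _ * (_ - _) in f0 *.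
by rewrite exprS invfM -!mulrA mulVf// mulr1.
Qed.

Lemma Hcoef0 h : Hcoef h 0 = 1.
Proof. by rewrite /Hcoef Hdenom0 expr0 divr1. Qed.

Local Notation H := (psum (Hcoef 1)).

(** Coefficientwise this is (k + 1) (k + 1 - theta) c_(k + 1) = - c_k. *)
Lemma H_ode x : x * psum (pseries_diffs (pseries_diffs (Hcoef 1))) x
  + (1 - theta) * psum (pseries_diffs (Hcoef 1)) x + H x = 0.
Proof.
have d0 := exp_dominated_Hcoef 1.
have d1 := exp_dominated_diffs d0; have d2 := exp_dominated_degree d1.
rewrite psum_euler// -psumZ// -psumD//; last exact: exp_dominatedZ.
rewrite -psumD//; last by apply: exp_dominatedD => //; exact: exp_dominatedZ.
rewrite (_ : (fun k => _) = (fun k => 0 * Hcoef 1 k)) ?psumZ ?mul0r//.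
apply/funext => k; rewrite mul0r /pseries_diffs.
by have := HcoefS 1 k; rewrite -natr1 => e; lra.
Qed.

Lemma H_at0 : H 0 = 1.
Proof. by rewrite psum_at0// Hcoef0. Qed.

(** For x <= 0 the terms of the series are nonnegative and the first one is 1. *)
Lemma H_ge1 x : x <= 0 -> 1 <= H x.
Proof.
move=> x0; rewrite -[leLHS]H_at0; apply: ler_psum => // k.
rewrite /Hcoef -[leRHS]mulrAC -exprMn mulN1r; case: k => [|k].
  by rewrite !expr0 mulr1 mul1r.
by rewrite expr0n/= mulr0 divr_ge0 ?exprn_ge0 ?oppr_ge0// ltW ?Hdenom_gt0.
Qed.

Lemma H_zero_gt0 x : H x = 0 -> 0 < x.
Proof. by move=> Hx; rewrite ltNge; apply/negP => /H_ge1; rewrite Hx ler10. Qed.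

Let DH (x : R) : is_derive x 1 H (psum (pseries_diffs (Hcoef 1)) x).
Proof. exact: psum_derive. Qed.

Let DH1 (x : R) : is_derive x 1 (psum (pseries_diffs (Hcoef 1)))
  (psum (pseries_diffs (pseries_diffs (Hcoef 1))) x).
Proof. by apply: psum_derive; exact: exp_dominated_diffs. Qed.

Let nu01 : 0 < 1 - theta < 1.
Proof. by have /andP[? ?] := theta01; apply/andP; split; lra. Qed.

(** Without zeros beyond x, the sign of H would be constant there by the
    intermediate value theorem, and either H or - H would be an eventually
    positive solution of the differential equation. *)
Lemma H_zeros_unbounded x : exists2 z, H z = 0 & x < z.
Proof.
apply: contrapT => noz.
have {}noz z : x < z -> H z != 0 by move=> xz; apply/eqP => Hz; apply: noz; exists z.
pose y := Num.max x 0 + 1.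
have y0 : 0 < y by rewrite ltr_wpDl// le_max lexx orbT.
have xy : x < y by rewrite (@le_lt_trans _ _ (Num.max x 0)) ?ltrDl// le_max lexx.
have sgn z : y < z -> 0 < H y * H z.
  move=> yz; rewrite ltNge; apply/negP => Hyz.
  have [| |c] := @IVT R H y z 0 (ltW yz).
  - by apply: continuous_subspaceT => u; exact: psum_continuous.
  - move: Hyz; rewrite ge_min le_max; have [Hy|Hy] := lerP (H y) 0; have [Hz|Hz] //= := lerP (H z) 0.
    + have n1 := noz _ (lt_trans xy yz); have n2 := noz y xy.
      by rewrite leNgt nmulr_rgt0 lt_neqAle ?n1 ?n2 ?Hy ?Hz.
    + by rewrite (ltW Hz) orbT.
    + by rewrite (ltW Hy) ?orbT.
    + by rewrite leNgt mulr_gt0.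
  - rewrite in_itv/= => /andP[yc _] /eqP; apply/negP/noz; exact: lt_le_trans yc.
have := noz y xy; rewrite neq_lt => /orP[Hy|Hy].
- apply: (@no_eventually_positive_solution R (1 - theta) y (fun z => - H z)
    (fun z => - psum (pseries_diffs (Hcoef 1)) z)
    (fun z => - psum (pseries_diffs (pseries_diffs (Hcoef 1))) z) nu01 y0).
  + by move=> z _; have D := DH z; exact: is_deriveN.
  + by move=> z _; have D := DH1 z; exact: is_deriveN.
  + by move=> z _; have := H_ode z; lra.
  + by move=> z /sgn; rewrite nmulr_rgt0// oppr_gt0.
- apply: (@no_eventually_positive_solution R (1 - theta) y H _ _ nu01 y0
    (fun z _ => DH z) (fun z _ => DH1 z)).
  + by move=> z _; exact: H_ode.
  + by move=> z /sgn; rewrite pmulr_rgt0.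
Qed.

Lemma H_zeros_enumeration : exists h : nat -> R,
  (forall m n : nat, (m < n)%N -> h m < h n) /\ range h = [set x | H x = 0].
Proof.
apply: increasing_enumeration => [x|x|p]; first exact: H_zero_gt0.
  by have [z] := H_zeros_unbounded x; exists z.
apply: (isolated_zero (DH p)) => Hp.
apply: (nonzero_slope nu01 (H_zero_gt0 Hp) DH DH1 H_ode) => //.
by rewrite H_at0 oner_eq0.
Qed.

End Hseries.

(** * Volterra operators on the unit interval *)
Lemma within_continuous_comp_stable (T U : topologicalType) (A : set T) (p : T -> T) (G : T -> U) :
  (forall x, A x -> A (p x)) -> {within A, continuous p} ->
  {within A, continuous G} -> {within A, continuous (G \o p)}.
Proof.
move=> Ap /subspace_continuousP cp /subspace_continuousP cG.
apply/subspace_continuousP => x Ax.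
have pA : p y @[y --> within A (nbhs x)] --> within A (nbhs (p x)).
  move=> B nB; have : nbhs x (fun y => A y -> A (p y) -> B (p y)) := cp x Ax _ nB.
  suff : (fun y => A y -> A (p y) -> B (p y)) `<=` (fun y => A y -> B (p y)) by exact: filterS.
  by move=> y h Ay; exact: (h Ay (Ap _ Ay)).
by move=> B nB; exact: (pA _ (cG _ (Ap _ Ax) _ nB)).
Qed.

Section volterra.
Context {R : realType}.
Local Notation mu := (@lebesgue_measure R).
Local Notation I := (@unit_itv R).
Implicit Types (b : R) (f g : R -> R).

(** The operator T_b on real functions, which is applied to the real and
    imaginary parts. *)
Definition volterra b f (x : R) : R := \int[mu]_(y in `[0, x `^ b]) f y.

Let mI : measurable (I : set R). Proof. exact: measurable_unit_itv. Qed.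
#[local] Hint Resolve mI : core.

Lemma sub_unit_itv (t : R) : 0 <= t <= 1 -> `[0, t] `<=` I.
Proof.
by move=> /andP[_ t1] y /=; rewrite in_itv/= unit_itvE => /andP[-> /le_trans]; exact.
Qed.

Lemma unit_itv_powR b x : 0 < b -> I x -> I (x `^ b).
Proof. by move=> b0; rewrite !unit_itvE => ?; exact: powR01. Qed.

Lemma integrable_initial b f x : 0 < b -> mu.-integrable I (EFin \o f) -> I x ->
  mu.-integrable `[0, x `^ b] (EFin \o f).
Proof.
move=> b0 fi Ix; apply: integrableS fi => //.
by apply: sub_unit_itv; rewrite -unit_itvE; exact: unit_itv_powR.
Qed.

Lemma volterra1 b f : volterra b f 1 = \int[mu]_(y in I) f y.
Proof. by rewrite /volterra powR1. Qed.

Lemma volterra0 b f : 0 < b -> volterra b f 0 = 0.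
Proof. by move=> b0; rewrite /volterra powR0 ?gt_eqF// set_itv1 Rintegral_set1. Qed.

Lemma volterra_continuous b f : 0 < b -> mu.-integrable I (EFin \o f) ->
  {within I, continuous (volterra b f)}.
Proof.
move=> b0 fi.
have cG := parameterized_integral_continuous (@ler01 R) fi.
apply: (@within_continuous_comp_stable R R I (fun x => x `^ b)
  (fun x => parameterized_integral mu 0 x f)) => //.
  by move=> x; exact: unit_itv_powR.
by apply: powR_within_continuous => //; exact: ltW.
Qed.

Lemma within_integrable f : {within I, continuous f} -> mu.-integrable I (EFin \o f).
Proof.
by move=> cf; apply: continuous_compact_integrable => //; exact: segment_compact.
Qed.

Lemma volterra_integrable b f : 0 < b -> mu.-integrable I (EFin \o f) ->
  mu.-integrable I (EFin \o volterra b f).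
Proof. by move=> b0 fi; apply/within_integrable/volterra_continuous. Qed.

Lemma ler_volterra b f g x : 0 < b -> mu.-integrable I (EFin \o f) ->
  mu.-integrable I (EFin \o g) -> (forall y, I y -> f y <= g y) -> I x ->
  volterra b f x <= volterra b g x.
Proof.
move=> b0 fi gi fg Ix; apply: le_Rintegral => //; do ?[exact: integrable_initial].
move=> y yx; apply: fg; apply: sub_unit_itv yx.
by rewrite -unit_itvE; exact: unit_itv_powR.
Qed.

Lemma volterraZ b (k : R) f x : 0 < b -> mu.-integrable I (EFin \o f) -> I x ->
  volterra b (fun y => k * f y) x = k * volterra b f x.
Proof. by move=> b0 fi Ix; rewrite /volterra RintegralZl//; exact: integrable_initial. Qed.

Lemma volterraD b f g x : 0 < b -> mu.-integrable I (EFin \o f) ->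
  mu.-integrable I (EFin \o g) -> I x ->
  volterra b (fun y => f y + g y) x = volterra b f x + volterra b g x.
Proof. by move=> b0 fi gi Ix; rewrite /volterra RintegralD//; exact: integrable_initial. Qed.

Lemma eq_volterra b f g x : 0 < b -> I x -> (forall y, I y -> f y = g y) ->
  volterra b f x = volterra b g x.
Proof.
move=> b0 Ix fg; apply: eq_Rintegral => y; rewrite inE => yx; apply: fg.
by apply: sub_unit_itv yx; rewrite -unit_itvE; exact: unit_itv_powR.
Qed.

Lemma ae_eq_Rintegral f g : mu.-integrable I (EFin \o f) ->
  measurable_fun I g -> ae_eq mu I f g -> \int[mu]_(y in I) f y = \int[mu]_(y in I) g y.
Proof.
move=> fi mg fg; rewrite /Rintegral; congr fine; apply: ae_eq_integral => //.
- exact: measurable_int fi.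
- exact/measurable_EFinP.
- exact: (ae_eq_comp EFin fg).
Qed.

Lemma ae_eq_volterra b f g x : 0 < b -> mu.-integrable I (EFin \o f) ->
  mu.-integrable I (EFin \o g) -> ae_eq mu I f g -> I x ->
  volterra b f x = volterra b g x.
Proof.
move=> b0 fi gi fg Ix; rewrite /volterra /Rintegral; congr fine.
have sub : `[0, x `^ b] `<=` I.
  by apply: sub_unit_itv; rewrite -unit_itvE; exact: unit_itv_powR.
apply: ae_eq_integral => //.
- exact: measurable_int (integrable_initial b0 fi Ix).
- exact: measurable_int (integrable_initial b0 gi Ix).
- by apply: filterS (ae_eq_comp EFin fg) => y h /sub; exact: h.
Qed.

Lemma integrable_normr f : mu.-integrable I (EFin \o f) ->
  mu.-integrable I (EFin \o (fun x => `|f x|)).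
Proof. by move=> /integrable_abse. Qed.

Lemma norm_volterra b f x : 0 < b -> mu.-integrable I (EFin \o f) -> I x ->
  `|volterra b f x| <= volterra b (fun y => `|f y|) x.
Proof. by move=> b0 fi Ix; apply: le_normr_Rintegral => //; exact: integrable_initial. Qed.

Lemma Rintegral_tail b f x : 0 < b -> mu.-integrable I (EFin \o f) -> I x ->
  \int[mu]_(y in `[x `^ b, 1]) f y = volterra b f 1 - volterra b f x.
Proof.
move=> b0 fi Ix; have := unit_itv_powR b0 Ix; rewrite unit_itvE => /andP[x0 x1].
rewrite volterra1 /volterra Rintegral_itvB//.
rewrite Rintegral_itv_obnd_cbnd//; apply: integrableS fi => //.
by apply: subset_itvScc; rewrite ?bnd_simp.
Qed.

(** By Lebesgue's differentiation theorem the primitive of f has the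
    derivative f x at almost every x in ]0, 1[. *)
Lemma primitive_eq0 f : mu.-integrable I (EFin \o f) ->
  (forall x, I x -> volterra 1 f x = 0) -> ae_eq mu I f (fun=> 0).
Proof.
move=> fi f0; pose g := f \_ I.
have gi : mu.-integrable setT (EFin \o g).
  by rewrite -restrict_EFin; apply/integrable_restrict => //; rewrite setTI.
have gS (A : set R) : measurable A -> mu.-integrable A (EFin \o g).
  by move=> mA; apply: integrableS gi.
have gl : locally_integrable [set: R] g by exact: integrable_locally.
have := @FTC1 R g (BLeft 0) (fun y => gS _ (measurable_itv _)) gl.
have : {ae mu, forall x, x != 0 /\ x != 1}.
  apply: (@negligibleS _ _ _ mu [set 0; 1]).
    move=> x /= h; have [->|x0] := eqVneq x 0; [left|right] => //.
    by apply: contrapT => x1; apply: h; split=> //; apply/eqP.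
  apply: negligibleU; apply/negligibleP => //; exact: lebesgue_measure_set1.
have FF := ae_filter_ringOfSetsType mu.
move=> ne ftc; apply: (@filterS2 _ _ FF _ _ _ _ ne ftc) => {ne ftc} x [x0 x1] ftc Ix.
have /andP[x0' x1'] : 0 <= x <= 1 by rewrite -unit_itvE.
have {x0 x0'}x0 : 0 < x by rewrite lt_neqAle eq_sym x0.
have {x1 x1'}x1 : x < 1 by rewrite lt_neqAle x1.
have [_] := ftc x0.
rewrite derive1E (_ : g x = f x); last by rewrite /g patchE mem_set.
move=> <-; rewrite (@near_eq_derive _ _ _ _ (fun=> 0)) ?derive_cst//; last first.
  near=> z; have /andP[z0 z1] : 0 < z < 1.
    apply/andP; split; near: z; [exact: lt_nbhsr|exact: lt_nbhsl].
  have Iz : I z by rewrite unit_itvE !ltW.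
  transitivity (volterra 1 f z); last exact: f0.
  rewrite /volterra powRr1 ?ltW//; apply: eq_Rintegral => y; rewrite inE/= in_itv/= => /andP[y0 yz].
  by rewrite /g patchE mem_set// unit_itvE y0 (le_trans yz)// ltW.
Unshelve. all: by end_near. Qed.

End volterra.

(** * The operator S and its eigenfunctions *)
Section double_volterra.
Context {R : realType}.
Local Notation mu := (@lebesgue_measure R).
Local Notation I := (@unit_itv R).
Implicit Types (b : R) (f g u w : R -> R).

Let mI : measurable (I : set R). Proof. exact: measurable_unit_itv. Qed.
#[local] Hint Resolve mI : core.

Lemma within_continuousZ (A : set R) (k : R) f :
  {within A, continuous f} -> {within A, continuous (fun x => k * f x)}.
Proof.
by move=> cf x; exact: (@continuousM R (subspace A) (fun=> k) f x (cvg_cst _) (cf x)).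
Qed.

(** A null set contains no interval, so a set of full measure is dense in
    [0, 1]. *)
Lemma within_ae_cst g (c : R) : {within I, continuous g} ->
  ae_eq mu I g (fun=> c) -> forall x, I x -> g x = c.
Proof.
move=> /subspace_continuousP cg [N [mN N0 sN]] x Ix; apply/eqP/negPn/negP => gxc.
have /(_ _ _)[|e /= e0 He] := cvgr_neq0 _ (cvgB (cg x Ix) (cvg_cst c)) _.
  by rewrite subr_eq0.
have /andP[x0 x1] : 0 <= x <= 1 by rewrite -unit_itvE.
(* The points of [0, 1] close to x form an interval of positive length. *)
pose l := Num.max 0 (x - e); pose r := Num.min 1 (x + e).
have lr : l < r.
  by rewrite /l /r gt_max !lt_min ltr01 /=; apply/andP; split; [|apply/andP; split]; lra.
have sub : `]l, r[ `<=` N.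
  move=> y; rewrite /= in_itv/= /l /r gt_max lt_min => /andP[/andP[y0 yl] /andP[y1 yr]].
  apply: sN => /= h; have Iy : I y by rewrite unit_itvE !ltW.
  suff : g y - c != 0 by rewrite (h Iy) subrr eqxx.
  by apply: He => //; rewrite /ball_/= ltr_norml; apply/andP; split; lra.
have : (mu `]l, r[ <= mu N)%E by apply: le_measure => //; rewrite inE.
by rewrite N0 lebesgue_measure_itv/= lte_fin lr -EFinD lee_fin leNgt subr_gt0 lr.
Qed.

Variable a : R.
Hypothesis a_gt0 : 0 < a.

Let ai_gt0 : 0 < a^-1. Proof. by rewrite invr_gt0. Qed.

(** The operator S: the tail integral in the adjoint of T_a is the difference
    between the values at 1 and at x of T_(1/a), so that T* T f = S f(1) - S f
    ([Talpha_adj_TalphaE]). *)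
Definition volterra2 f : R -> R := volterra a^-1 (volterra a f).

Local Notation S := volterra2.
Local Notation theta := ((1 + a)^-1).
Local Notation beta := ((1 + a) / a).
Local Notation K := (a / (1 + a) ^+ 2).

Lemma volterra2_continuous f : mu.-integrable I (EFin \o f) -> {within I, continuous (S f)}.
Proof. by move=> fi; apply: volterra_continuous => //; exact: volterra_integrable. Qed.

Lemma volterra2_integrable f : mu.-integrable I (EFin \o f) -> mu.-integrable I (EFin \o S f).
Proof. by move=> fi; do 2 apply: volterra_integrable => //. Qed.

Lemma volterra2_0 f : S f 0 = 0. Proof. exact: volterra0. Qed.

Lemma volterra2Z (k : R) f x : mu.-integrable I (EFin \o f) -> I x ->
  S (fun y => k * f y) x = k * S f x.
Proof.
move=> fi Ix; rewrite -volterraZ//; last exact: volterra_integrable.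
by apply: eq_volterra => // y Iy; exact: volterraZ.
Qed.

Lemma volterra2D f g x : mu.-integrable I (EFin \o f) ->
  mu.-integrable I (EFin \o g) -> I x ->
  S (fun y => f y + g y) x = S f x + S g x.
Proof.
move=> fi gi Ix; rewrite -volterraD//; do ?exact: volterra_integrable.
by apply: eq_volterra => // y Iy; exact: volterraD.
Qed.

Lemma ae_eq_volterra2 f g x : mu.-integrable I (EFin \o f) ->
  mu.-integrable I (EFin \o g) -> ae_eq mu I f g -> I x -> S f x = S g x.
Proof. by move=> fi gi fg Ix; apply: eq_volterra => // y Iy; exact: ae_eq_volterra. Qed.

Lemma ler_volterra2 f g x : mu.-integrable I (EFin \o f) ->
  mu.-integrable I (EFin \o g) -> (forall y, I y -> f y <= g y) -> I x ->
  S f x <= S g x.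
Proof.
move=> fi gi fg Ix; apply: ler_volterra => //; do ?exact: volterra_integrable.
by move=> y Iy; exact: ler_volterra.
Qed.

Lemma norm_volterra2 f x : mu.-integrable I (EFin \o f) -> I x ->
  `|S f x| <= S (fun y => `|f y|) x.
Proof.
move=> fi Ix; have vi := volterra_integrable a_gt0 fi.
apply: (le_trans (norm_volterra ai_gt0 vi Ix)).
apply: ler_volterra => //; first exact: integrable_normr.
- by apply: volterra_integrable => //; exact: integrable_normr.
- by move=> y Iy; exact: norm_volterra.
Qed.

(** As S f vanishes at 0, the hypothesis gives S f = 0 on [0, 1] by continuity.
    Since S is a composition of two primitives, up to increasing changes of
    variable, it remains to differentiate twice. *)
Lemma volterra2_inj f : mu.-integrable I (EFin \o f) ->
  ae_eq mu I (fun x => S f 1 - S f x) (fun=> 0) -> ae_eq mu I f (fun=> 0).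
Proof.
move=> fi Sf; have I0 : I 0 by rewrite unit_itvE lexx ler01.
have S0 x : I x -> S f x = 0.
  have H : forall x, I x -> S f x = S f 1.
    apply: within_ae_cst; first exact: volterra2_continuous.
    by apply: filterS Sf => y h Iy; exact/esym/subr0_eq/h.
  by move=> Ix; rewrite H// -(H 0)// volterra2_0.
have pw (b x : R) : 0 < b -> I x -> (x `^ b^-1) `^ b = x.
  move=> b0; rewrite unit_itvE => /andP[x0 _].
  by rewrite -powRrM mulVf ?gt_eqF// powRr1.
have V0 : forall x, I x -> volterra a f x = 0.
  apply: within_ae_cst; first exact: volterra_continuous.
  apply: primitive_eq0; first exact: volterra_integrable.
  move=> x Ix; rewrite -[RHS](S0 (x `^ a)); last exact: unit_itv_powR.
  have x0 : 0 <= x by move: Ix; rewrite unit_itvE => /andP[].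
  by rewrite /volterra2 [RHS]/volterra -powRrM mulfV ?gt_eqF.
apply: (primitive_eq0 fi) => x Ix.
rewrite -[RHS](V0 (x `^ a^-1)); last exact: unit_itv_powR.
by rewrite /volterra pw// powRr1//; move: Ix; rewrite unit_itvE => /andP[].
Qed.

Lemma psum_beta_continuous c : exp_dominated c ->
  {within I, continuous (fun x => psum c (x `^ beta))}.
Proof.
move=> cd.
have b0 : 0 <= beta by rewrite divr_ge0 ?addr_ge0 ?ltW.
rewrite (_ : (fun x => _) = (fun x => x `^ 0 * psum c (x `^ beta))).
  exact: psum_powR_within_continuous.
by apply/funext => x; rewrite powRr0 mul1r.
Qed.

Lemma psum_beta_integrable c : exp_dominated c ->
  mu.-integrable I (EFin \o (fun x => psum c (x `^ beta))).
Proof. by move=> cd; apply/within_integrable/psum_beta_continuous. Qed.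

(** S sends x^(beta k) to x^(beta (k + 1)) divided by
    (1 + beta k) (1 + a) (k + 1) = (k + 1) (k + 1 - theta) / K. *)
Lemma volterra2_psum c e x : exp_dominated c -> exp_dominated e -> I x ->
  (forall k, e k.+1 * (k.+1%:R * (k.+1%:R - theta)) = K * c k) ->
  S (fun x => psum c (x `^ beta)) x = psum e (x `^ beta) - e 0%N.
Proof.
move=> cd ed Ix ec.
have b0 : 0 < beta by rewrite divr_gt0 ?addr_gt0.
have a10 : 0 < 1 + a by rewrite addr_gt0.
have pos (y s : R) : 0 <= y `^ s by exact: powR_ge0.
pose d k := c k / (0 + 1 + beta * k%:R).
have dd : exp_dominated d by apply: exp_dominated_primitive.
transitivity (volterra a^-1 (fun v => v `^ a * psum d (v `^ (1 + a))) x).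
  apply: eq_volterra => // v Iv; rewrite /volterra.
  transitivity (\int[mu]_(y in `[0, v `^ a]) (y `^ 0 * psum c (y `^ beta))).
    by apply: eq_Rintegral => y _ /=; rewrite powRr0 mul1r.
  rewrite (Rintegral_powR_psum cd (lexx 0) b0 (pos _ _)) add0r -!powRrM mulr1.
  have -> : a * beta = 1 + a by rewrite mulrC divfK ?gt_eqF.
  by rewrite /d add0r.
rewrite /volterra (Rintegral_powR_psum dd (ltW a_gt0) a10 (pos _ _)).
have e1 : a^-1 * (1 + a) = beta by rewrite mulrC.
have e2 : a^-1 * (a + 1) = beta by rewrite addrC.
rewrite -!powRrM e1 e2.
rewrite (psum_shift _ ed) addrAC subrr add0r; congr (_ * psum _ _).
apply/funext => k; rewrite /d.
have f0 := lt0r_neq0 (Hfactor_gt0 a_gt0 k).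
apply: (mulIf f0); rewrite ec.
have k0 : 0 <= k%:R :> R by [].
rewrite -natr1; field.
have ak0 : 0 <= (1 + a) * k%:R by rewrite mulr_ge0// ltW.
by apply/and4P; split; rewrite gt_eqF// ltr_pwDl// addr_gt0.
Qed.

(** A positive eigenvalue l, its candidate eigenfunction phi, and the series E
    with the absolute values of the same coefficients. *)
Variable l : R.
Hypothesis l_gt0 : 0 < l.
Local Notation h := (K / l).
Local Notation phi := (fun x => psum (Hcoef a h) (x `^ beta)).
Local Notation E := (fun x => psum (Hcoef a (- h)) (x `^ beta)).

Let lhK : l * h = K.
Proof. by rewrite mulrC divfK// gt_eqF. Qed.

Lemma volterra2_phi x : I x -> S phi x = l - l * phi x.
Proof.
move=> Ix; have cd := exp_dominated_Hcoef a_gt0 h.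
rewrite (@volterra2_psum _ (fun k => - l * Hcoef a h k))//; last 2 first.
- exact: exp_dominatedZ.
- by move=> k /=; rewrite -[LHS]mulrA HcoefS// mulrA mulrNN lhK.
by rewrite (psumZ (- l) _ cd) Hcoef0; ring.
Qed.

Let h_ge0 : 0 <= h.
Proof. by rewrite !divr_ge0 ?sqr_ge0 ?ltW. Qed.

Let volterra2_E x : I x -> S E x = l * E x - l.
Proof.
move=> Ix; have cd := exp_dominated_Hcoef a_gt0 (- h).
rewrite (@volterra2_psum _ (fun k => l * Hcoef a (- h) k))//; last 2 first.
- exact: exp_dominatedZ.
- by move=> k /=; rewrite -[LHS]mulrA HcoefS// mulrA opprK lhK.
by rewrite (psumZ l _ cd) Hcoef0 mulr1.
Qed.

Let Hcoef_ge0 k : 0 <= Hcoef a (- h) k.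
Proof. by rewrite /Hcoef opprK divr_ge0 ?exprn_ge0// ltW// Hdenom_gt0. Qed.

Let E_bounds x : I x -> 1 <= E x <= E 1.
Proof.
move=> Ix; have cd := exp_dominated_Hcoef a_gt0 (- h).
have /andP[x0 x1] : 0 <= x `^ beta <= 1.
  by apply: powR01; [rewrite divr_gt0 ?addr_gt0|rewrite -unit_itvE].
apply/andP; split.
  rewrite -[leLHS](Hcoef0 a (- h)) -[leLHS](psum_at0 cd); apply: ler_psum => // k.
  by rewrite ler_wpM2l// lerXn2r ?nnegrE.
apply: ler_psum => // k; rewrite ler_wpM2l// powR1 expr1n.
by rewrite exprn_ile1.
Qed.

(** A contraction argument in the norm sup |w| / E.  If |w| <= m E, then
    l |w| <= S |w| <= m S E = l m (E - 1) <= l m (1 - 1 / E 1) E, so the least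
    such m is at most (1 - 1 / E 1) m. *)
Lemma volterra2_unique w M : mu.-integrable I (EFin \o w) ->
  (forall x, I x -> `|w x| <= M) -> (forall x, I x -> l * w x = - S w x) ->
  forall x, I x -> w x = 0.
Proof.
move=> wi wM wS.
have E0 x : I x -> 0 < E x by move=> /E_bounds/andP[+ _]; exact: lt_le_trans.
have I1 : I 1 by rewrite unit_itvE lexx ler01.
pose A := [set `|w x| / E x | x in I].
have A0 : A !=set0 by exists (`|w 1| / E 1), 1.
have uA : has_ubound A.
  exists M => _ [x Ix <-]; rewrite ler_pdivrMr ?E0// (le_trans (wM _ Ix))//.
  rewrite ler_peMr ?(le_trans _ (wM _ Ix))//.
  by have /andP[] := E_bounds Ix.
pose m := sup A.
have wm x : I x -> `|w x| <= m * E x.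
  by move=> Ix; rewrite -ler_pdivrMr ?E0//; apply: ub_le_sup => //; exists x.
have m0 : 0 <= m.
  by have := wm 1 I1; rewrite -ler_pdivrMr ?E0//; apply: le_trans; rewrite divr_ge0// ltW ?E0.
have Ei : mu.-integrable I (EFin \o E) by apply: psum_beta_integrable; exact: exp_dominated_Hcoef.
have mEi : mu.-integrable I (EFin \o (fun x => m * E x)).
  apply/within_integrable/within_continuousZ/psum_beta_continuous.
  exact: exp_dominated_Hcoef.
have step x : I x -> `|w x| <= m * (E x - 1).
  move=> Ix; rewrite -(ler_pM2l l_gt0) -[X in X * _](gtr0_norm l_gt0) -normrM wS// normrN.
  apply: (le_trans (norm_volterra2 wi Ix)).
  apply: (@le_trans _ _ (S (fun x => m * E x) x)).
    by apply: ler_volterra2 => //; exact: integrable_normr.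
  by rewrite volterra2Z// volterra2_E// mulrCA -[l in _ - l]mulr1 -mulrBr.
have mq : m <= m * (1 - (E 1)^-1).
  apply: ge_sup => // _ [x Ix <-]; rewrite ler_pdivrMr ?E0//.
  apply: (le_trans (step x Ix)); rewrite -[leRHS]mulrA ler_wpM2l// mulrBl mul1r lerD2l lerN2.
  by rewrite mulrC ler_pdivrMr ?E0// mul1r; have /andP[] := E_bounds Ix.
have {mq}m_eq0 : m = 0.
  apply/eqP; rewrite eq_le m0 andbT; move: mq.
  rewrite mulrBr mulr1 => mE; rewrite leNgt; apply/negP => m_gt0; move: mE; rewrite leNgt => /negP; apply.
  by rewrite ltrBlDr ltrDl divr_gt0// E0.
by move=> x /wm; rewrite m_eq0 mul0r normr_le0 => /eqP.
Qed.

(** The function (S u 1 - S u) / l is a continuous version of u with the value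
    C = S u 1 / l at 0 and 0 at 1.  It differs from C phi by a solution of
    l w = - S w, so it equals C phi everywhere, in particular at 1. *)
Lemma volterra2_eigenfunction u : mu.-integrable I (EFin \o u) ->
  ae_eq mu I (fun x => S u 1 - S u x) (fun x => l * u x) ->
  exists2 C, ae_eq mu I u (fun x => C * phi x) & C * phi 1 = 0.
Proof.
move=> ui uS; have l0 : l != 0 by rewrite gt_eqF.
have I1 : I 1 by rewrite unit_itvE lexx ler01.
pose u' x := (S u 1 - S u x) / l.
pose C := S u 1 / l.
have uu' : ae_eq mu I u u'.
  by apply: filterS uS => x H /H; rewrite /u' => ->; rewrite mulrC mulKf.
have Su_cont := volterra2_continuous ui.
have phii : {within I, continuous phi} by apply: psum_beta_continuous; exact: exp_dominated_Hcoef.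
have u'c : {within I, continuous u'}.
  rewrite (_ : u' = fun x => l^-1 * (S u 1 - S u x)).
    apply: within_continuousZ => x.
    by apply: cvgB; [exact: cvg_cst|exact: Su_cont].
  by apply/funext => x; rewrite /u' mulrC.
have Su' x : I x -> S u' x = S u x.
  by move=> Ix; apply/esym/ae_eq_volterra2 => //; exact: within_integrable.
pose w x := u' x + - C * phi x.
have Cphi : {within I, continuous (fun x => - C * phi x)}.
  exact: within_continuousZ.
have wc : {within I, continuous w}.
  by move=> x; apply: cvgD; [exact: u'c|exact: Cphi].
have w0 : forall x, I x -> w x = 0.
  have [M [_ HM]] : bounded_set (w @` I).
    by apply/compact_bounded/continuous_compact => //; exact: segment_compact.
  apply: (@volterra2_unique w (M + 1)); first exact: within_integrable.
    by move=> x Ix; apply: (HM (M + 1)); [rewrite ltrDl|exists x].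
  move=> x Ix; rewrite volterra2D//; try exact: within_integrable.
  rewrite volterra2Z//; last exact: within_integrable.
  rewrite (Su' _ Ix) (volterra2_phi Ix) /w /u' /C.
  move: (S u 1) (S u x) (psum _ _) => p q r; field.
  exact: l0.
exists C.
  apply: filterS uu' => x H Ix; rewrite (H Ix); apply/subr0_eq.
  by rewrite -mulNr; exact: w0.
by have := w0 1 I1; rewrite /w /u' subrr mul0r add0r mulNr => /eqP; rewrite oppr_eq0 => /eqP.
Qed.

End double_volterra.

(** * Complex coefficients *)
Section complex_series.
Context {R : realType}.
Implicit Types (w : R[i]).
Local Notation ReC := (@complex.Re R).
Local Notation ImC := (@complex.Im R).

Lemma norm_complexE w : `|w| = (Normc.normc w)%:C.
Proof. by rewrite normc_def; case: w. Qed.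

Lemma normr_real (x : R) : `|x%:C| = `|x|%:C :> R[i].
Proof. by rewrite normc_def/= expr0n/= addr0 sqrtr_sqr. Qed.

Lemma real_complexXV (x y : R) k : (x ^+ k / y)%:C = x%:C ^+ k / y%:C.
Proof.
by rewrite (rmorphM (real_complex R)) (fmorphV (real_complex R)) (rmorphXn (real_complex R)).
Qed.

Lemma norm_Re_le w : `|ReC w| <= Normc.normc w.
Proof.
by case: w => u v /=; rewrite -sqrtr_sqr ler_wsqrtr// lerDl sqr_ge0.
Qed.

Lemma norm_Im_le w : `|ImC w| <= Normc.normc w.
Proof.
by case: w => u v /=; rewrite -sqrtr_sqr ler_wsqrtr// lerDr sqr_ge0.
Qed.

Lemma normc_le w : Normc.normc w <= `|ReC w| + `|ImC w|.
Proof.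
case: w => u v /=; rewrite -(ger0_norm (addr_ge0 (normr_ge0 u) (normr_ge0 v))) -sqrtr_sqr.
apply: ler_wsqrtr; rewrite sqrrD !real_normK ?num_real// addrAC lerDl.
by rewrite mulrn_wge0// mulr_ge0.
Qed.

Lemma cvg_complex (p q : nat -> R) (u v : R) : p @ \oo --> u -> q @ \oo --> v ->
  (fun n => (p n +i* q n : R[i]^o)) @ \oo --> (u +i* v : R[i]^o).
Proof.
move=> pu qv; apply/cvgrPdist_lt => -[e e']; rewrite ltcE/= => /andP[/eqP e'0 e0].
rewrite {e'}e'0; near=> n; rewrite norm_complexE (ltcR (Normc.normc _) e).
rewrite (le_lt_trans (normc_le _))//= (splitr e) ltrD//.
- by near: n; have /cvgrPdist_lt/(_ _ (divr_gt0 e0 (ltr0Sn _ 1))) := pu.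
- by near: n; have /cvgrPdist_lt/(_ _ (divr_gt0 e0 (ltr0Sn _ 1))) := qv.
Unshelve. all: by end_near. Qed.

(** The variable stays real: only [0, 1] matters for eigenfunctions, and the
    complex zero z is put in the coefficients. *)
Definition complex_psum (c : nat -> R[i]) (x : R) : R[i] :=
  psum (ReC \o c) x +i* psum (ImC \o c) x.

Definition complex_dominated (c : nat -> R[i]) :=
  exp_dominated (ReC \o c) /\ exp_dominated (ImC \o c).

Lemma lim_complex_series (c : nat -> R[i]) : complex_dominated c ->
  limn (series (c : nat -> R[i]^o)) = complex_psum c 1.
Proof.
move=> [cr ci]; apply: cvg_lim => //.
suff -> : series (c : nat -> R[i]^o) =
    (fun n => pseries (ReC \o c) 1 n +i* pseries (ImC \o c) 1 n : R[i]^o).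
  exact: (cvg_complex (@psum_cvg _ _ 1 cr) (@psum_cvg _ _ 1 ci)).
apply/funext => n; rewrite /pseries/series/=.
elim: n => [|n IH]; first by rewrite !big_geq.
rewrite !big_nat_recr//= IH expr1n !mulr1.
by case: (c n).
Qed.

Lemma complex_psumZ (l : R[i]) c x : complex_dominated c ->
  complex_psum (fun k => l * c k) x = l * complex_psum c x.
Proof.
case: l => p q [cr ci]; rewrite /complex_psum.
have -> : ReC \o (fun k => (p +i* q) * c k) = fun k => p * (ReC \o c) k + - q * (ImC \o c) k.
  by apply/funext => k /=; case: (c k) => u v /=; rewrite mulNr.
have -> : ImC \o (fun k => (p +i* q) * c k) = fun k => p * (ImC \o c) k + q * (ReC \o c) k.
  by apply/funext => k /=; case: (c k) => u v /=; rewrite addrC [q * _]mulrC addrC.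
rewrite !psumD ?psumZ//; do ?exact: exp_dominatedZ.
by rewrite mulNr/=; congr (_ +i* _); rewrite [q * _]mulrC.
Qed.

Lemma complex_dominatedZ (l : R[i]) c : complex_dominated c ->
  complex_dominated (fun k => l * c k).
Proof.
case: l => p q [cr ci]; split.
- rewrite (_ : _ \o _ = fun k => p * (ReC \o c) k + - q * (ImC \o c) k).
    by apply: exp_dominatedD; exact: exp_dominatedZ.
  by apply/funext => k /=; case: (c k) => u v /=; rewrite mulNr.
- rewrite (_ : _ \o _ = fun k => p * (ImC \o c) k + q * (ReC \o c) k).
    by apply: exp_dominatedD; exact: exp_dominatedZ.
  by apply/funext => k /=; case: (c k) => u v /=; rewrite addrC [q * _]mulrC addrC.
Qed.

Variable a : R.
Hypothesis a_gt0 : 0 < a.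

Definition Hcoefc (z : R[i]) k : R[i] := (- z) ^+ k / (Hdenom a k)%:C.

Lemma Hcoefc_dominated z : complex_dominated (Hcoefc z).
Proof.
have n k : Normc.normc (Hcoefc z k) = Normc.normc z ^+ k / Hdenom a k.
  apply: complexI; rewrite -norm_complexE normrM normrX normrN normfV normr_real.
  rewrite (ger0_norm (ltW (Hdenom_gt0 a_gt0 k))) norm_complexE.
  by rewrite real_complexXV.
have z0 : 0 <= Normc.normc z by rewrite -ler0c -norm_complexE.
split; apply: (exp_dominated_Hdenom a_gt0 z0) => k; rewrite -n.
- exact: norm_Re_le.
- exact: norm_Im_le.
Qed.

Lemma HalphaE z : Halpha a z = complex_psum (Hcoefc z) 1.
Proof. exact/lim_complex_series/Hcoefc_dominated. Qed.

Lemma Halpha_real (x : R) : Halpha a x%:C = (psum (Hcoef a 1) x)%:C.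
Proof.
rewrite HalphaE /complex_psum.
have e k : Hcoefc x%:C k = (Hcoef a x k)%:C.
  by rewrite /Hcoefc /Hcoef real_complexXV (rmorphN (real_complex R)).
rewrite (_ : ReC \o _ = Hcoef a x); last by apply/funext => k /=; rewrite e.
rewrite (_ : ImC \o _ = fun k => 0 * Hcoef a x k); last by apply/funext => k /=; rewrite e mul0r.
by rewrite (psumZ 0 _ (exp_dominated_Hcoef a_gt0 x)) mul0r psum_Hcoef mulr1.
Qed.

Lemma eigenfunE (h x : R) :
  eigenfun a h x = (psum (Hcoef a h) (x `^ ((1 + a) / a)))%:C.
Proof.
rewrite /eigenfun /psum; set u := series _; suff -> : u = pseries (Hcoef a h) (x `^ ((1 + a) / a)) by [].
apply/funext => n; apply: eq_bigr => k _ /=.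
have -> : (1 + a) * k%:R / a = (1 + a) / a * k%:R by rewrite mulrAC.
by rewrite (powRrM x ((1 + a) / a) k%:R) powR_mulrn ?powR_ge0.
Qed.

Lemma Hcoefc0 z : Hcoefc z 0 = 1.
Proof. by rewrite /Hcoefc Hdenom0 expr0 divr1. Qed.

Lemma HcoefcS z k :
  Hcoefc z k.+1 * (k.+1%:R * (k.+1%:R - (1 + a)^-1))%:C = - z * Hcoefc z k.
Proof.
have f0 := lt0r_neq0 (Hfactor_gt0 a_gt0 k).
rewrite /Hcoefc HdenomS; move: (Hdenom a k) (_ * (_ - _)) f0 => d p p0.
have pC : p%:C != 0 :> R[i] by rewrite fmorph_eq0.
by rewrite (rmorphM (real_complex R)) exprS invfM -!mulrA mulVf// mulr1.
Qed.

End complex_series.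

(** * The operator T* T on complex-valued functions *)
Section eigenspaces.
Context {R : realType}.
Variable a : R.
Hypothesis a_gt0 : 0 < a.
Local Notation mu := (@lebesgue_measure R).
Local Notation I := (@unit_itv R).
Local Notation S := (volterra2 a).
Local Notation TT := (Talpha_adj a \o Talpha a).
Local Notation K := (a / (1 + a) ^+ 2).
Local Notation beta := ((1 + a) / a).
Local Notation ReC := (@complex.Re R).
Local Notation ImC := (@complex.Im R).
Implicit Types f : R -> R[i].

Let mI : measurable (I : set R). Proof. exact: measurable_unit_itv. Qed.
#[local] Hint Resolve mI : core.
Let ai_gt0 : 0 < a^-1. Proof. by rewrite invr_gt0. Qed.
Let I1 : I 1. Proof. by rewrite unit_itvE lexx ler01. Qed.
Let I0 : I 0. Proof. by rewrite unit_itvE lexx ler01. Qed.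

Lemma Talpha_adj_TalphaE f x :
  mu.-integrable I (EFin \o (ReC \o f)) -> mu.-integrable I (EFin \o (ImC \o f)) -> I x ->
  TT f x = (S (ReC \o f) 1 - S (ReC \o f) x) +i* (S (ImC \o f) 1 - S (ImC \o f) x).
Proof.
move=> ri ii Ix; rewrite /= /Talpha_adj /cintegral.
have vr := volterra_integrable a_gt0 ri; have vi := volterra_integrable a_gt0 ii.
by congr (_ +i* _); [exact: Rintegral_tail vr Ix|exact: Rintegral_tail vi Ix].
Qed.

Lemma integrableZ_EFin (k : R) (g : R -> R) : mu.-integrable I (EFin \o g) ->
  mu.-integrable I (EFin \o (fun x => k * g x)).
Proof.
move=> gi.
have : mu.-integrable I (fun x => k%:E * (EFin \o g) x)%E by exact: integrableZl.
by apply: eq_integrable => // x _; rewrite /= EFinM.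
Qed.

Lemma Re_mulJ (w w' : R[i]) : ReC (w * conjc w') = ReC w * ReC w' + ImC w * ImC w'.
Proof. by case: w w' => u v [p q] /=; ring. Qed.

Lemma Im_mulJ (w w' : R[i]) : ImC (w * conjc w') = ImC w * ReC w' - ReC w * ImC w'.
Proof. by case: w w' => u v [p q] /=; ring. Qed.

Lemma normc_sqr (w : R[i]) : Normc.normc w ^+ 2 = ReC w ^+ 2 + ImC w ^+ 2.
Proof. by case: w => u v; rewrite sqr_sqrtr// addr_ge0 ?sqr_ge0. Qed.

Lemma continuous_L2 f : {within I, continuous (ReC \o f)} ->
  {within I, continuous (ImC \o f)} -> L2 f.
Proof.
move=> cr ci; split.
- by apply/measurable_EFinP; apply: measurable_int (within_integrable cr).
- by apply/measurable_EFinP; apply: measurable_int (within_integrable ci).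
- have c2 : {within I, continuous (fun x => Normc.normc (f x) ^+ 2)}.
    rewrite (_ : (fun x => _) =
      fun x => (ReC \o f) x * (ReC \o f) x + (ImC \o f) x * (ImC \o f) x); last first.
      by apply/funext => x; rewrite normc_sqr !expr2.
    by move=> x; apply: cvgD; apply: cvgM; [exact: cr|exact: cr|exact: ci|exact: ci].
  have /integrableP[_] := within_integrable c2.
  by under eq_integral do rewrite gee0_abs ?lee_fin ?sqr_ge0//.
Qed.

Lemma integrable_normc_sqr f : L2 f ->
  mu.-integrable I (EFin \o (fun x => Normc.normc (f x) ^+ 2)).
Proof.
move=> [mr mi fi]; apply/integrableP; split.
  apply/measurable_EFinP; rewrite (_ : (fun x => _) =
      fun x => (ReC \o f) x ^+ 2 + (ImC \o f) x ^+ 2).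
    by apply: measurable_funD; exact: measurable_funX.
  by apply/funext => x; rewrite normc_sqr.
by under eq_integral do rewrite gee0_abs ?lee_fin ?sqr_ge0//.
Qed.

Lemma Talpha_continuous f : L2 f ->
  {within I, continuous (ReC \o Talpha a f)} /\ {within I, continuous (ImC \o Talpha a f)}.
Proof.
by move=> /L2_integrable[ri ii]; split; [exact: volterra_continuous ri|exact: volterra_continuous ii].
Qed.

Lemma L2norm_gt0 f : L2 f -> ~ L2eq f (fun=> 0) ->
  0 < \int[mu]_(x in I) (Normc.normc (f x) ^+ 2).
Proof.
move=> fL f0; rewrite lt_neqAle Rintegral_ge0 ?andbT; last by move=> x _; exact: sqr_ge0.
apply/eqP => i0; apply: f0; have fi := integrable_normc_sqr fL.
have : (\int[mu]_(x in I) `|(Normc.normc (f x) ^+ 2)%:E| = 0)%E.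
  under eq_integral do rewrite gee0_abs ?lee_fin ?sqr_ge0//.
  rewrite -[RHS]/(0%:E) [in RHS]i0 /Rintegral fineK//.
  exact: integrable_fin_num.
move=> /(ae_eq_integral_abs mu mI (measurable_int mu fi)).1; apply: filterS => x H /H.
move=> [] /eqP; rewrite sqrf_eq0 => /eqP; exact: Normc.eq0_normc.
Qed.

(** With N g the squared norm of g, the adjunction identity for f and T f reads
    N (T f) = conj l * N f, and N f > 0. *)
Lemma eigenvalue_ge0 f (l : R[i]) : L2_eigenspace TT l f -> ~ L2eq f (fun=> 0) ->
  exists2 r : R, 0 <= r & l = r%:C.
Proof.
move=> [fL fe] f0; have [ri ii] := L2_integrable fL.
have [cr ci] := Talpha_continuous fL.
have TL := continuous_L2 cr ci.
have := Talpha_adjP a_gt0 fL TL.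
pose N g := \int[mu]_(x in I) (Normc.normc (g x) ^+ 2).
have inner_self g : L2inner g g = (N g)%:C.
  rewrite /L2inner /cintegral; congr (_ +i* _).
    by apply: eq_Rintegral => x _; rewrite normc_sqr; case: (g x) => u v /=; ring.
  rewrite (_ : (fun x => _) = fun=> 0) ?Rintegral_cst ?mul0r//.
  by apply/funext => x; case: (g x) => u v /=; ring.
have Nf : 0 < N f by exact: L2norm_gt0.
rewrite inner_self.
have -> : L2inner f (Talpha_adj a (Talpha a f)) = conjc l * (N f)%:C.
  have [mr mi _] := fL.
  pose G x := (S (ReC \o f) 1 - S (ReC \o f) x) +i* (S (ImC \o f) 1 - S (ImC \o f) x).
  have TG x : I x -> Talpha_adj a (Talpha a f) x = G x by exact: Talpha_adj_TalphaE.
  have mG : measurable_fun I (ReC \o G) /\ measurable_fun I (ImC \o G).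
    split; apply: measurable_funB => //; apply/measurable_EFinP;
      exact: measurable_int (volterra2_integrable a_gt0 _).
  have fG : ae_eq mu I (fun x => f x * conjc (G x))
      (fun x => conjc l * (Normc.normc (f x) ^+ 2)%:C).
    apply: filterS fe => x H Ix; have {}H : G x = l * f x by rewrite -TG//; exact: H.
    change (f x * conjc (G x) = conjc l * (Normc.normc (f x) ^+ 2)%:C).
    rewrite H normc_sqr.
    by case: (f x) => u v; case: (l) => p q /=; congr (_ +i* _); ring.
  have iN := integrable_normc_sqr fL.
  have Re_eq : \int[mu]_(x in I) ReC (f x * conjc (Talpha_adj a (Talpha a f) x)) = ReC l * N f.
    rewrite -RintegralZl//; transitivity (\int[mu]_(x in I) ReC (f x * conjc (G x))).
      by apply: eq_Rintegral => x; rewrite inE => Ix; rewrite TG.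
    apply/esym/ae_eq_Rintegral.
    - exact: integrableZ_EFin iN.
    - rewrite (_ : (fun x => _) = fun x => (ReC \o f) x * (ReC \o G) x + (ImC \o f) x * (ImC \o G) x).
        by apply: measurable_funD; apply: measurable_funM => //; [exact: mG.1|exact: mG.2].
      by apply/funext => x; exact: Re_mulJ.
    - apply: filterS fG => x H Ix; rewrite (H Ix).
      by case: (l) => p q /=; rewrite mulr0 subr0.
  have Im_eq : \int[mu]_(x in I) ImC (f x * conjc (Talpha_adj a (Talpha a f) x)) = - ImC l * N f.
    rewrite -RintegralZl//; transitivity (\int[mu]_(x in I) ImC (f x * conjc (G x))).
      by apply: eq_Rintegral => x; rewrite inE => Ix; rewrite TG.
    apply/esym/ae_eq_Rintegral.
    - exact: integrableZ_EFin iN.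
    - rewrite (_ : (fun x => _) = fun x => (ImC \o f) x * (ReC \o G) x - (ReC \o f) x * (ImC \o G) x).
        by apply: measurable_funB; apply: measurable_funM => //; [exact: mG.1|exact: mG.2].
      by apply/funext => x; exact: Im_mulJ.
    - apply: filterS fG => x H Ix; rewrite (H Ix).
      by case: (l) => p q /=; rewrite mulr0 add0r.
  rewrite /L2inner /cintegral Re_eq Im_eq.
  by case: (l) => p q /=; congr (_ +i* _); ring.
move=> e.
have N0 : (N f)%:C != 0 :> R[i] by rewrite fmorph_eq0 gt_eqF.
exists (N (Talpha a f) / N f).
  by rewrite divr_ge0 ?(ltW Nf)//; apply: Rintegral_ge0 => x _; exact: sqr_ge0.
apply: (can_inj (@conjcK R)); rewrite conjc_real; apply: (mulIf N0); rewrite -e.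
by rewrite -(rmorphM (real_complex R)) divfK ?gt_eqF.
Qed.

End eigenspaces.

(** * Spectrum and eigenspaces *)
Section spectrum.
Context {R : realType}.
Variable a : R.
Hypothesis a_gt0 : 0 < a.
Local Notation mu := (@lebesgue_measure R).
Local Notation I := (@unit_itv R).
Local Notation S := (volterra2 a).
Local Notation TT := (Talpha_adj a \o Talpha a).
Local Notation K := (a / (1 + a) ^+ 2).
Local Notation beta := ((1 + a) / a).
Local Notation ReC := (@complex.Re R).
Local Notation ImC := (@complex.Im R).
Local Notation H := (psum (Hcoef a 1)).
Implicit Types f : R -> R[i].

Let I1 : I 1. Proof. by rewrite unit_itvE lexx ler01. Qed.
Let I0 : I 0. Proof. by rewrite unit_itvE lexx ler01. Qed.
Let K_gt0 : 0 < K. Proof. by rewrite divr_gt0 ?exprn_gt0 ?addr_gt0. Qed.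

Let complex_eqP (w w' : R[i]) : ReC w = ReC w' -> ImC w = ImC w' -> w = w'.
Proof. by case: w w' => u v [p q] /= -> ->. Qed.

Let ReM (r : R) (w : R[i]) : ReC (r%:C * w) = r * ReC w.
Proof. by case: w => u v /=; rewrite mul0r subr0. Qed.

Let ImM (r : R) (w : R[i]) : ImC (r%:C * w) = r * ImC w.
Proof. by case: w => u v /=; rewrite mul0r addr0. Qed.

Let ReMr (w : R[i]) (r : R) : ReC (w * r%:C) = ReC w * r.
Proof. by rewrite mulrC ReM mulrC. Qed.

Let ImMr (w : R[i]) (r : R) : ImC (w * r%:C) = ImC w * r.
Proof. by rewrite mulrC ImM mulrC. Qed.

(** For a real eigenvalue the equation separates into real and imaginary
    parts. *)
Lemma eigenspace_realP (r : R) f : L2_eigenspace TT r%:C f <->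
  [/\ L2 f,
      ae_eq mu I (fun x => S (ReC \o f) 1 - S (ReC \o f) x) (fun x => r * (ReC \o f) x) &
      ae_eq mu I (fun x => S (ImC \o f) 1 - S (ImC \o f) x) (fun x => r * (ImC \o f) x)].
Proof.
split=> [[fL fe]|[fL er ei]]; have [ri ii] := L2_integrable fL.
- split=> //; apply: filterS fe => x E Ix; have := E Ix; rewrite Talpha_adj_TalphaE//.
  + by move=> /(congr1 ReC); rewrite ReM.
  + by move=> /(congr1 ImC); rewrite ImM.
- split=> //; have FF := ae_filter_ringOfSetsType mu.
  apply: (@filterS2 _ _ FF _ _ _ _ er ei) => x E F Ix.
  rewrite Talpha_adj_TalphaE//; apply: complex_eqP; rewrite ?ReM ?ImM.
  + exact: E.
  + exact: F.
Qed.

Lemma L2eq_complex f g : L2eq f g <->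
  ae_eq mu I (ReC \o f) (ReC \o g) /\ ae_eq mu I (ImC \o f) (ImC \o g).
Proof.
split=> [fg|[fr fi]]; first by split; exact: ae_eq_comp fg.
have FF := ae_filter_ringOfSetsType mu.
apply: (@filterS2 _ _ FF _ _ _ _ fr fi) => x E F Ix.
by apply: complex_eqP; [exact: E|exact: F].
Qed.

Lemma eigenvalue_neq0 f : L2_eigenspace TT 0 f -> L2eq f (fun=> 0).
Proof.
move=> /(eigenspace_realP 0)[fL er ei]; have [ri ii] := L2_integrable fL.
apply/L2eq_complex; split; apply: (volterra2_inj a_gt0) => //.
- by apply: filterS er => x E Ix; rewrite E// mul0r.
- by apply: filterS ei => x E Ix; rewrite E// mul0r.
Qed.

Lemma eigenfun_continuous (h : R) : {within I, continuous (ReC \o eigenfun a h)} /\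
  {within I, continuous (ImC \o eigenfun a h)}.
Proof.
split.
- rewrite (_ : _ \o _ = fun x => psum (Hcoef a h) (x `^ beta)).
    by apply: psum_beta_continuous => //; exact: exp_dominated_Hcoef.
  by apply/funext => x; rewrite -[LHS]/(ReC (eigenfun a h x)) eigenfunE.
- rewrite (_ : _ \o _ = fun=> 0); first by move=> x; exact: cvg_cst.
  by apply/funext => x; rewrite -[LHS]/(ImC (eigenfun a h x)) eigenfunE.
Qed.

Lemma eigenfun_L2 (h : R) : L2 (eigenfun a h).
Proof. by have [? ?] := eigenfun_continuous h; exact: continuous_L2. Qed.

Lemma eigenfun_neq0 (h : R) : ~ L2eq (eigenfun a h) (fun=> 0).
Proof.
move=> /L2eq_complex[e _]; have [c _] := eigenfun_continuous h.
have := within_ae_cst c e I0.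
rewrite -[LHS]/(ReC (eigenfun a h 0)) -[RHS]/(0 : R) eigenfunE.
rewrite -[LHS]/(psum (Hcoef a h) (0 `^ beta)) powR0.
  by rewrite (psum_at0 (exp_dominated_Hcoef a_gt0 h)) Hcoef0 => /eqP; rewrite oner_eq0.
by rewrite gt_eqF// divr_gt0 ?addr_gt0.
Qed.

Lemma eigenspace_generated (l : R) f : 0 < l -> L2_eigenspace TT l%:C f ->
  exists2 C : R[i], L2eq f (fun x => C * eigenfun a (K / l) x) & C * (H (K / l))%:C = 0.
Proof.
move=> l0 /eigenspace_realP[fL er ei]; have [ri ii] := L2_integrable fL.
have [p pe p1] := volterra2_eigenfunction a_gt0 l0 ri er.
have [q qe q1] := volterra2_eigenfunction a_gt0 l0 ii ei.
exists (p +i* q).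
- apply/L2eq_complex; split.
  + apply: filterS pe => x E Ix; rewrite (E Ix).
    by rewrite -[RHS]/(ReC ((p +i* q) * eigenfun a (K / l) x)) eigenfunE ReMr.
  + apply: filterS qe => x E Ix; rewrite (E Ix).
    by rewrite -[RHS]/(ImC ((p +i* q) * eigenfun a (K / l) x)) eigenfunE ImMr.
- move: p1 q1; rewrite powR1 psum_Hcoef mulr1 => p1 q1.
  by apply: complex_eqP; rewrite /= ?mulr0 ?subr0 ?add0r.
Qed.

Lemma eigenspace_zeroE (h : R) : H h = 0 ->
  L2_eigenspace TT (K * h^-1)%:C = L2span (eigenfun a h).
Proof.
move=> Hh; have h0 := H_zero_gt0 a_gt0 Hh.
have l0 : 0 < K / h by rewrite divr_gt0.
have Kl : K / (K / h) = h by rewrite invf_div mulrC divfK ?gt_eqF.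
have phi1 : psum (Hcoef a h) (1 `^ beta) = 0 by rewrite powR1 psum_Hcoef mulr1.
apply/seteqP; split=> f.
- move=> fe; split; first by case: fe.
  by have [C] := eigenspace_generated l0 fe; rewrite Kl; exists C.
- move=> [fL [[p q] /L2eq_complex[er ei]]]; have [ri ii] := L2_integrable fL.
  pose phi x := psum (Hcoef a h) (x `^ beta).
  have phii : mu.-integrable I (EFin \o phi).
    by apply: psum_beta_integrable => //; exact: exp_dominated_Hcoef.
  have gen u k : mu.-integrable I (EFin \o u) -> ae_eq mu I u (fun x => k * phi x) ->
      ae_eq mu I (fun x => S u 1 - S u x) (fun x => K / h * u x).
    move=> ui ue; apply: filterS (ue) => x E Ix.
    have Su y : I y -> S u y = k * (K / h - K / h * phi y).
      move=> Iy; rewrite (ae_eq_volterra2 a_gt0 ui _ ue Iy); last exact: integrableZ_EFin.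
      rewrite volterra2Z//; congr (_ * _).
      by have := volterra2_phi a_gt0 l0 Iy; rewrite Kl.
    rewrite !Su// E// {1}/phi phi1; ring.
  apply/eigenspace_realP; split=> //.
  + apply: (gen _ p) => //; apply: filterS er => x E Ix.
    by rewrite (E Ix) -[LHS]/(ReC ((p +i* q) * eigenfun a h x)) eigenfunE ReMr.
  + apply: (gen _ q) => //; apply: filterS ei => x E Ix.
    by rewrite (E Ix) -[LHS]/(ImC ((p +i* q) * eigenfun a h x)) eigenfunE ImMr.
Qed.

Lemma point_spectrumE :
  L2_point_spectrum TT = [set (K * h^-1)%:C | h in [set h | H h = 0]].
Proof.
apply/seteqP; split=> l.
- move=> [f fe f0]; have [r r0 lr] := eigenvalue_ge0 a_gt0 fe f0; subst l.
  have {r0}r0 : 0 < r.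
    rewrite lt_neqAle r0 andbT; apply/eqP => r00; apply: f0.
    by apply: eigenvalue_neq0; move: fe; rewrite -r00.
  have [C Cf /eqP] := eigenspace_generated r0 fe.
  rewrite mulf_eq0 => /orP[/eqP C0|].
    by exfalso; apply: f0; apply: filterS Cf => x E Ix; rewrite E// C0 mul0r.
  rewrite fmorph_eq0 => /eqP HK; exists (K / r) => //.
  by rewrite invf_div mulrC divfK// gt_eqF.
- move=> [h Hh <-]; exists (eigenfun a h); last exact: eigenfun_neq0.
  rewrite eigenspace_zeroE//; split; first exact: eigenfun_L2.
  by exists 1; apply: aeW => x Ix; rewrite mul1r.
Qed.

(** The function f with the values H(z x^beta) is an eigenfunction of T* T for
    K / z, so K / z is positive by [eigenvalue_ge0] and [eigenvalue_neq0]. *)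
Lemma Halpha_zero_real (z : R[i]) : Halpha a z = 0 -> exists2 r : R, 0 < r & z = r%:C.
Proof.
move=> Hz; have d := Hcoefc_dominated a_gt0 z.
have z0 : z != 0.
  apply/eqP => z0; have : Halpha a (0 : R)%:C = 0 by rewrite -Hz z0.
  by rewrite Halpha_real// H_at0// => -[/eqP]; rewrite oner_eq0.
pose l := K%:C / z.
have lz : l * z = K%:C by rewrite divfK.
have ld := complex_dominatedZ (- l) d.
pose f x := complex_psum (Hcoefc a z) (x `^ beta).
have f1 : f 1 = 0 by rewrite /f powR1 -HalphaE.
have fc : {within I, continuous (ReC \o f)} /\ {within I, continuous (ImC \o f)}.
  by split; apply: psum_beta_continuous => //; case: d.
have [rc ic] := fc.
have fL := continuous_L2 rc ic.
have [ri ii] := L2_integrable fL.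
have Sf x : I x -> S (ReC \o f) x +i* S (ImC \o f) x = l - l * f x.
  move=> Ix.
  have step k : - l * Hcoefc a z k.+1 * (k.+1%:R * (k.+1%:R - (1 + a)^-1))%:C = K%:C * Hcoefc a z k.
    by rewrite -mulrA HcoefcS// mulrA mulrNN lz.
  have := @volterra2_psum _ a a_gt0 _ (ReC \o (fun k => - l * Hcoefc a z k)) x d.1 ld.1 Ix.
  have := @volterra2_psum _ a a_gt0 _ (ImC \o (fun k => - l * Hcoefc a z k)) x d.2 ld.2 Ix.
  move=> si sr.
  transitivity (complex_psum (fun k => - l * Hcoefc a z k) (x `^ beta) - - l * Hcoefc a z 0).
    rewrite /complex_psum sr; last first.
      by move=> k; have /(congr1 ReC) := step k; rewrite ReM ReMr.
    rewrite si; last first.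
      by move=> k; have /(congr1 ImC) := step k; rewrite ImM ImMr.
    rewrite -[(ReC \o _) 0%N]/(ReC (- l * Hcoefc a z 0)).
    rewrite -[(ImC \o _) 0%N]/(ImC (- l * Hcoefc a z 0)).
    by case: (- l * Hcoefc a z 0) => u v.
  by rewrite complex_psumZ// Hcoefc0 /f; ring.
have fe : L2_eigenspace TT l f.
  split=> //; apply: aeW => x Ix; rewrite Talpha_adj_TalphaE//.
  transitivity (S (ReC \o f) 1 +i* S (ImC \o f) 1 - (S (ReC \o f) x +i* S (ImC \o f) x)).
    by apply: complex_eqP.
  apply: (eq_trans (f_equal2 (fun p q => p - q) (Sf 1 I1) (Sf x Ix))).
  by rewrite f1 mulr0 subr0 opprB addrC subrK.
have fn0 : ~ L2eq f (fun=> 0).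
  move=> /L2eq_complex[e _]; have := within_ae_cst rc e I0.
  rewrite -[LHS]/(psum (ReC \o Hcoefc a z) (0 `^ beta)) -[RHS]/(0 : R) powR0.
    rewrite (psum_at0 d.1) -[LHS]/(ReC (Hcoefc a z 0)) Hcoefc0.
    by move/eqP; rewrite oner_eq0.
  by rewrite gt_eqF// divr_gt0 ?addr_gt0.
have [r r0 lr] := eigenvalue_ge0 a_gt0 fe fn0.
have rn0 : r != 0.
  by apply/eqP => r00; apply: fn0; apply: eigenvalue_neq0; move: fe; rewrite lr r00.
exists (K / r); first by rewrite divr_gt0// lt_neqAle eq_sym rn0.
have rC0 : r%:C != 0 :> R[i] by rewrite fmorph_eq0.
apply: (mulfI rC0); rewrite -lr lz lr -(rmorphM (real_complex R)).
by rewrite [r * _]mulrC divfK.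
Qed.

End spectrum.

Unset Implicit Arguments.

Theorem theorem5 (R : realType) (a : R) (a_gt0 : 0 < a) :
  (forall z : R[i], Halpha a z = 0 -> exists2 r : R, 0 < r & z = r%:C) /\
  exists h : nat -> R,
    [/\ forall m n : nat, (m < n)%N -> h m < h n,
        [set z : R[i] | Halpha a z = 0] = [set (h n)%:C | n in [set: nat]],
        L2_point_spectrum (Talpha_adj a \o Talpha a) =
          [set (a / (1 + a) ^+ 2 * (h n)^-1)%:C | n in [set: nat]],
        forall l : R[i], L2_point_spectrum (Talpha_adj a \o Talpha a) l ->
          one_dimensional (L2_eigenspace (Talpha_adj a \o Talpha a) l) &
        forall n : nat,
          generated_by
            (L2_eigenspace (Talpha_adj a \o Talpha a) (a / (1 + a) ^+ 2 * (h n)^-1)%:C)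
            (eigenfun a (h n))].
Proof.
split; first exact: Halpha_zero_real.
have [h [hinc hH]] := H_zeros_enumeration a_gt0.
have Hh n : psum (Hcoef a 1) (h n) = 0.
  by suff : range h (h n); [rewrite hH|exists n].
exists h; split; first exact: hinc.
- apply/seteqP; split=> z /=.
  + move=> Hz; have [r _ zr] := Halpha_zero_real a_gt0 Hz.
    suff : range h r by move=> [n _ hn]; exists n; rewrite ?hn ?zr.
    by rewrite hH; apply: complexI; rewrite -(Halpha_real a_gt0 r) -zr.
  + by move=> [n _ <-]; rewrite Halpha_real// Hh.
- rewrite point_spectrumE//; apply/seteqP; split=> l.
  + move=> [x Hx <-]; have [n _ <-] : range h x by rewrite hH.
    by exists n.
  + by move=> [n _ <-]; exists (h n).
- move=> l; rewrite point_spectrumE// => -[x Hx <-].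
  exists (eigenfun a x); split; [exact: eigenfun_L2|exact: eigenfun_neq0|].
  exact: eigenspace_zeroE.
- by move=> n; split; [exact: eigenfun_L2|exact: eigenspace_zeroE].
Qed.
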